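(* Assume $(\mathbf{H}_f)$ and $(\mathbf{H}_g)$. For every $\eta\in C^{\beta\text{-Hol}}([-r,0],\mathbb{R}^d)$ there exists a unique solution $x\in C^{\beta\text{-Hol}}([-r,T],\mathbb{R}^d)$ of $$x(t)=\eta(0)+\int_0^tf(x_s)\,ds+\int_0^tg(x_s)\,d\omega(s),\quad t\in[0,T],\qquad x_0=\eta.$$ Moreover, the restriction of this solution to $[0,T]$ is $\nu$-Hölder continuous.
   Context: $\|\cdot\|$ is the Euclidean norm; $r,T>0$; $C_r:=C([-r,0],\mathbb{R}^d)$ with sup norm $\|\xi\|_{\infty,[-r,0]}$; for a path $x$ and $t$, $x_t\in C_r$ is $x_t(u)=x(t+u)$. For $0<\alpha\le1$, $C^{\alpha\text{-Hol}}([a,b],\mathbb{R}^d)$ is the space of paths with $|||x|||_{\alpha,[a,b]}=\sup_{a\le s<t\le b}\frac{\|x(t)-x(s)\|}{(t-s)^\alpha}<\infty$. Parameters: $\nu\in(\tfrac12,1]$; $\omega\in C^{\nu\text{-Hol}}([0,T],\mathbb{R})$ with moreover $\lim_{h\to0}\sup_{0\le s<t\le T,\,t-s\le h}\frac{|\omega(t)-\omega(s)|}{(t-s)^\nu}=0$; $\delta$ with $\frac{1-\nu}{\nu}<\delta\le1$; $\beta\in(0,\nu)$ with $\beta\delta+\nu>1$. $(\mathbf{H}_f)$: $f:C_r\to\mathbb{R}^d$ with $\|f(\xi)-f(\eta)\|\le L_f\|\xi-\eta\|_{\infty,[-r,0]}$. $(\mathbf{H}_g)$: $g:C_r\to\mathbb{R}^d$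 Fréchet $C^1$, $\|Dg(\xi)\|_{L(C_r,\mathbb{R}^d)}\le L_g$ for all $\xi$, and for each $M>0$ there is $L_M$ with $\|Dg(\xi)-Dg(\eta)\|\le L_M\|\xi-\eta\|^\delta_{\infty,[-r,0]}$ whenever $\|\xi\|_{\infty,[-r,0]},\|\eta\|_{\infty,[-r,0]}\le M$. The integral against $\omega$ is a Young integral. $x_0=\eta$ means $x(u)=\eta(u)$ for $u\in[-r,0]$. *)

(* Defs.v *)
From mathcomp Require Import ssreflect ssrfun ssrbool eqtype ssrnat fintype bigop.
From Stdlib Require Import Reals ClassicalEpsilon.
Open Scope R_scope.

Definition Vec (d : nat) := 'I_d -> R.
Definition vadd {d} (u v : Vec d) : Vec d := fun i => u i + v i.
Definition vsub {d} (u v : Vec d) : Vec d := fun i => u i - v i.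
Definition vscal {d} (c : R) (u : Vec d) : Vec d := fun i => c * u i.
Definition vconst {d} (c : R) : Vec d := fun _ => c.
Definition vnorm {d} (u : Vec d) : R := sqrt (\big[Rplus/0]_(i < d) (u i * u i)).

(* supremum of a set of reals (0 if empty or unbounded above) *)
Definition Rsup (E : R -> Prop) : R :=
  match excluded_middle_informative (bound E /\ exists x, E x) with
  | left H => proj1_sig (completeness E (proj1 H) (proj2 H))
  | right _ => 0
  end.

(* a^p for a >= 0, p > 0, with 0^p = 0 *)
Definition rpow (a p : R) : R := if Rle_dec a 0 then 0 else Rpower a p.

(* The interval [-r,0] and C_r = C([-r,0], R^d).  Elements of C_r are the
   maps Dr r -> R^d satisfying [Cr_cont]; all hypotheses quantify over those. *)
Definition Dr (r : R) := { u : R | - r <= u <= 0 }.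
Definition Cr_cont {r d} (xi : Dr r -> Vec d) : Prop :=
  forall u : Dr r, forall eps, 0 < eps -> exists del, 0 < del /\
    forall v : Dr r, Rabs (proj1_sig v - proj1_sig u) < del ->
      vnorm (vsub (xi v) (xi u)) < eps.
Definition Cr_norm {r d} (xi : Dr r -> Vec d) : R :=
  Rsup (fun a => exists u : Dr r, a = vnorm (xi u)).
Definition Cr_add {r d} (xi h : Dr r -> Vec d) : Dr r -> Vec d :=
  fun u => vadd (xi u) (h u).
Definition Cr_sub {r d} (xi h : Dr r -> Vec d) : Dr r -> Vec d :=
  fun u => vsub (xi u) (h u).
Definition Cr_scal {r d} (c : R) (h : Dr r -> Vec d) : Dr r -> Vec d :=
  fun u => vscal c (h u).

Definition segment {d} (r : R) (x : R -> Vec d) (t : R) : Dr r -> Vec d :=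
  fun u => x (t + proj1_sig u).

Definition is_holder {d} (alpha : R) (x : R -> Vec d) (a b : R) : Prop :=
  exists K, forall s t, a <= s -> s < t -> t <= b ->
    vnorm (vsub (x t) (x s)) <= K * Rpower (t - s) alpha.

Definition is_holder1 (alpha : R) (w : R -> R) (a b : R) : Prop :=
  exists K, forall s t, a <= s -> s < t -> t <= b ->
    Rabs (w t - w s) <= K * Rpower (t - s) alpha.

Definition holder_little_o (nu : R) (w : R -> R) (T : R) : Prop :=
  forall eps, 0 < eps -> exists h, 0 < h /\
    forall s t, 0 <= s -> s < t -> t <= T -> t - s <= h ->
      Rabs (w t - w s) / Rpower (t - s) nu <= eps.

(* Riemann–Stieltjes sums and integral (limit as mesh -> 0, arbitrary tags).
   With w = id this is the Riemann integral; with w = omega and Hölder data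
   it is the Young integral. *)
Fixpoint rsum (n : nat) (F : nat -> R) : R :=
  match n with O => 0 | S m => rsum m F + F m end.
Definition RS_sum {d} (y : R -> Vec d) (w : R -> R) (n : nat) (p q : nat -> R)
  : Vec d := fun k => rsum n (fun i => y (q i) k * (w (p (S i)) - w (p i))).
Definition RS_integral {d} (y : R -> Vec d) (w : R -> R) (a b : R) (I : Vec d)
  : Prop :=
  forall eps, 0 < eps -> exists m, 0 < m /\
    forall (n : nat) (p q : nat -> R),
      p O = a -> p n = b ->
      (forall i, (i < n)%coq_nat -> p i < p (S i)) ->
      (forall i, (i < n)%coq_nat -> p (S i) - p i < m) ->
      (forall i, (i < n)%coq_nat -> p i <= q i <= p (S i)) ->
      vnorm (vsub (RS_sum y w n p q) I) < eps.

Definition Hf {d} (r : R) (f : (Dr r -> Vec d) -> Vec d) : Prop :=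
  exists Lf, forall xi eta, Cr_cont xi -> Cr_cont eta ->
    vnorm (vsub (f xi) (f eta)) <= Lf * Cr_norm (Cr_sub xi eta).

Definition Hg {d} (r delta : R) (g : (Dr r -> Vec d) -> Vec d) : Prop :=
  exists (Dg : (Dr r -> Vec d) -> (Dr r -> Vec d) -> Vec d) (Lg : R),
    (forall xi h1 h2, Cr_cont xi -> Cr_cont h1 -> Cr_cont h2 ->
       Dg xi (Cr_add h1 h2) = vadd (Dg xi h1) (Dg xi h2)) /\
    (forall xi c h, Cr_cont xi -> Cr_cont h ->
       Dg xi (Cr_scal c h) = vscal c (Dg xi h)) /\
    (forall xi h, Cr_cont xi -> Cr_cont h ->
       vnorm (Dg xi h) <= Lg * Cr_norm h) /\
    (forall xi, Cr_cont xi -> forall eps, 0 < eps -> exists rho, 0 < rho /\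
       forall h, Cr_cont h -> Cr_norm h < rho ->
         vnorm (vsub (vsub (g (Cr_add xi h)) (g xi)) (Dg xi h))
           <= eps * Cr_norm h) /\
    (forall xi, Cr_cont xi -> forall eps, 0 < eps -> exists rho, 0 < rho /\
       forall eta, Cr_cont eta -> Cr_norm (Cr_sub eta xi) < rho ->
         forall h, Cr_cont h ->
           vnorm (vsub (Dg eta h) (Dg xi h)) <= eps * Cr_norm h) /\
    (forall M, 0 < M -> exists LM, forall xi eta, Cr_cont xi -> Cr_cont eta ->
       Cr_norm xi <= M -> Cr_norm eta <= M ->
       forall h, Cr_cont h ->
         vnorm (vsub (Dg xi h) (Dg eta h))
           <= LM * rpow (Cr_norm (Cr_sub xi eta)) delta * Cr_norm h).

Definition solves {d} (r T : R) (f g : (Dr r -> Vec d) -> Vec d) (w : R -> R)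
  (eta x : R -> Vec d) : Prop :=
  (forall u, - r <= u <= 0 -> x u = eta u) /\
  (forall t, 0 <= t <= T -> exists I1 I2,
     RS_integral (fun s => f (segment r x s)) (fun s => s) 0 t I1 /\
     RS_integral (fun s => g (segment r x s)) w 0 t I2 /\
     x t = vadd (vadd (eta 0) I1) I2).

(* Main.v *)
(* Solutions are the fixed points of the Picard map, which sends a path x to
   eta(0) + int f(x) ds + int g(x) dw.
   Young integrals are obtained by sewing the germ y(s)(w(t) - w(s)): the defect
   is of order (t - s)^(alpha + nu) with alpha + nu > 1, so Riemann sums over any
   partition stay within a constant times (t - s)^(alpha + nu) of the germ.
   Paths on [0,T] are measured by the least N such that
   |z(t) - z(s)| <= N exp(t/h) (t - s)^beta whenever 0 <= s <= t <= T and t - s <= h.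
   The weight exp(t/h) makes the sup norm of z up to time t at most
   2 N exp(t/h) h^beta, without loss on the whole of [0,T], and the spare
   exponent nu - beta yields a factor h^(nu - beta).  As g grows linearly, a small
   h gives an invariant ball; the members of this ball share a beta-Hölder bound,
   which bounds the local Hölder constant of Dg, and a smaller h then makes the
   Picard map contract distances by 1/2 on all of [0,T].  No concatenation of
   local solutions is needed.  Estimates are coordinatewise; vnorm only enters
   through its equivalence with the maximum of the coordinates. *)
Require Import Defs.
From mathcomp Require Import ssreflect ssrfun ssrbool eqtype ssrnat seq fintype bigop.
From Stdlib Require Import Reals Lra Lia ClassicalEpsilon FunctionalExtensionality.
Open Scope R_scope.

(** * Real powers and finite sums *)

(** The obstacle is that [Dg] is only delta-Hölder. Even if x and y are close in the beta-Hölder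
    sense, s |-> g(x_s) - g(y_s) is controlled only with exponent beta*delta, so differences are
    sewn with exponent beta*delta + nu, while single paths are sewn with beta + nu. The contraction
    estimate contains L_M and a beta-Hölder constant H of the paths, so H has to be known before the
    contraction scale is chosen. It comes from the invariant ball, whose estimate is affine in the
    radius because the first-order bound on g is global. Hence two scales occur, fixed in the order
    h1, R0, H, M, L_M, h. The delay makes the integrand at time s depend on x over [s-r, s], usually
    far longer than a window of length h. An increasing weight handles this: segments reach only
    into the past, where the weight is smaller. Uniqueness needs the contraction alone, with an H
    that suits both solutions. The nu-Hölder bound is the increment estimate of the Picard map once
    more, with beta replaced by nu. *)

Lemma Rabs_le_bounds (x c : R) : Rabs x <= c -> - c <= x <= c.
Proof. unfold Rabs; destruct (Rcase_abs x); lra. Qed.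

Ltac abs_lra :=
  repeat match goal with
  | H : Rabs _ <= _ |- _ => apply Rabs_le_bounds in H
  end; first [apply Rabs_le; lra | lra].

Lemma Rdiv_ge0 (a b : R) : 0 <= a -> 0 < b -> 0 <= a / b.
Proof. intros Ha Hb; apply Rmult_le_pos; [|left; apply Rinv_0_lt_compat]; lra. Qed.

Lemma rpow_ge0 (a p : R) : 0 <= rpow a p.
Proof.
  unfold rpow; destruct (Rle_dec a 0); simpl; [lra|].
  left; apply exp_pos.
Qed.

Lemma rpow_0 (p : R) : rpow 0 p = 0.
Proof. unfold rpow; destruct (Rle_dec 0 0); simpl; lra. Qed.

Lemma rpow_pos (a p : R) : 0 < a -> rpow a p = Rpower a p.
Proof. intros Ha; unfold rpow; destruct (Rle_dec a 0); simpl; lra. Qed.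

Lemma rpow_gt0 (a p : R) : 0 < a -> 0 < rpow a p.
Proof. intros Ha; rewrite rpow_pos; [|lra]. apply exp_pos. Qed.

Lemma rpow_le (a b p : R) : a <= b -> 0 <= p -> rpow a p <= rpow b p.
Proof.
  intros Hab Hp.
  destruct (Rle_dec a 0) as [Ha|Ha].
  - unfold rpow at 1; destruct (Rle_dec a 0); simpl; [apply rpow_ge0|lra].
  - rewrite (rpow_pos a) ?(rpow_pos b); try lra.
    apply Rle_Rpower_l; lra.
Qed.

Lemma rpow_add (a p q : R) : 0 <= a -> rpow a (p + q) = rpow a p * rpow a q.
Proof.
  intros [Ha|<-]; [|rewrite !rpow_0; ring].
  rewrite !rpow_pos; try lra. apply Rpower_plus.
Qed.

Lemma rpow_mul (a b p : R) : 0 <= a -> 0 <= b -> rpow (a * b) p = rpow a p * rpow b p.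
Proof.
  intros [Ha|<-]; [|rewrite Rmult_0_l !rpow_0; intros; ring].
  intros [Hb|<-]; [|rewrite Rmult_0_r !rpow_0; ring].
  rewrite !rpow_pos; try lra; [|apply Rmult_lt_0_compat; lra].
  symmetry; apply Rpower_mult_distr; lra.
Qed.

Lemma rpow_rpow (a p q : R) : 0 <= a -> rpow (rpow a p) q = rpow a (p * q).
Proof.
  intros [Ha|<-]; [|rewrite !rpow_0; ring].
  rewrite (rpow_pos (rpow a p)); [|apply rpow_gt0; lra].
  rewrite !rpow_pos; try lra. apply Rpower_mult.
Qed.

Lemma rpow_1r (a : R) : 0 <= a -> rpow a 1 = a.
Proof.
  intros [Ha|<-]; [|apply rpow_0].
  rewrite rpow_pos; try lra. apply Rpower_1; lra.
Qed.

Lemma rpow_1l (p : R) : rpow 1 p = 1.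
Proof. rewrite rpow_pos; [|lra]. unfold Rpower; rewrite ln_1 Rmult_0_r; apply exp_0. Qed.

(** Trading the exponent p for a smaller q on a short interval; this is the origin of the factor
    h^(nu - beta). *)
Lemma rpow_weaken (a b p q : R) :
  0 <= a -> a <= b -> q <= p -> rpow a p <= rpow b (p - q) * rpow a q.
Proof.
  intros Ha Hab Hqp.
  replace p with ((p - q) + q) at 1 by ring.
  rewrite rpow_add; [|lra].
  apply Rmult_le_compat_r; [apply rpow_ge0|].
  apply rpow_le; lra.
Qed.

Lemma rpow_le1 (a p q : R) : 0 <= a -> a <= 1 -> q <= p -> rpow a p <= rpow a q.
Proof.
  intros Ha Ha1 Hqp.
  generalize (rpow_weaken a 1 p q Ha Ha1 Hqp); rewrite rpow_1l; lra.
Qed.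

Lemma rpow_small (p eps : R) : 0 < p -> 0 < eps -> exists h, 0 < h <= 1 /\ rpow h p <= eps.
Proof.
  intros Hp He.
  exists (Rmin 1 (rpow eps (/ p))).
  assert (Hr := rpow_gt0 eps (/ p) He).
  split; [split; [apply Rmin_glb_lt; lra|apply Rmin_l]|].
  apply Rle_trans with (rpow (rpow eps (/ p)) p).
  - apply rpow_le; [apply Rmin_r|lra].
  - rewrite rpow_rpow; [|lra]. rewrite Rinv_l; [|lra]. rewrite rpow_1r; lra.
Qed.

Lemma le_of_all_eps (a b c : R) : (forall eps, 0 < eps -> a <= b + c * eps) -> a <= b.
Proof.
  intros H. apply Rle_plus_epsilon; intros e He.
  assert (Hc : 0 < Rabs c + 1) by (generalize (Rabs_pos c); lra).
  assert (Hd : 0 < e / (Rabs c + 1)) by (apply Rdiv_lt_0_compat; lra).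
  specialize (H _ Hd).
  assert (c * (e / (Rabs c + 1)) <= (Rabs c + 1) * (e / (Rabs c + 1))).
  { apply Rmult_le_compat_r; [lra|]. generalize (Rle_abs c); lra. }
  replace ((Rabs c + 1) * (e / (Rabs c + 1))) with e in H0 by (field; lra).
  lra.
Qed.

(** The explicit rate matters: it is used for grid sums, for Picard iterates and for the increments
    of Picard iterates. *)
Lemma geometric_limit (u : nat -> R) (c q : R) :
  0 <= q < 1 -> (forall n, Rabs (u (S n) - u n) <= c * q ^ n) ->
  exists l, forall n, Rabs (l - u n) <= c / (1 - q) * q ^ n.
Proof.
  intros Hq Hu.
  assert (Hc : 0 <= c).
  { generalize (Hu O) (Rabs_pos (u 1%nat - u O)); simpl; lra. }
  set (K := c / (1 - q)).
  assert (HK : 0 <= K) by (apply Rdiv_ge0; lra).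
  assert (HcK : c = K * (1 - q)) by (unfold K; field; lra).
  (* The factor 1 - q^k, a partial geometric sum, makes the induction on k close exactly. *)
  assert (Hk : forall n k, Rabs (u (k + n)%coq_nat - u n) <= K * q ^ n * (1 - q ^ k)).
  { intros n; induction k as [|k IH].
    - simpl. rewrite Rminus_diag Rabs_R0. lra.
    - simpl. specialize (Hu (k + n)%coq_nat).
      rewrite pow_add HcK in Hu.
      replace (u (S (k + n)%coq_nat) - u n)
        with ((u (S (k + n)%coq_nat) - u (k + n)%coq_nat) + (u (k + n)%coq_nat - u n)) by ring.
      eapply Rle_trans; [apply Rabs_triang|].
      eapply Rle_trans; [apply Rplus_le_compat; [exact Hu|exact IH]|].
      apply Req_le; ring. }
  assert (Hk' : forall n k, Rabs (u (k + n)%coq_nat - u n) <= K * q ^ n).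
  { intros n k. eapply Rle_trans; [apply Hk|].
    assert (0 <= q ^ k) by (apply pow_le; lra).
    assert (0 <= K * q ^ n) by (apply Rmult_le_pos; [lra|apply pow_le; lra]).
    nra. }
  assert (Hlim : forall e, 0 < e -> exists N, K * q ^ N < e).
  { intros e He.
    destruct (pow_lt_1_zero q) with (y := e / (K + 1)) as [N HN].
    - rewrite Rabs_right; lra.
    - apply Rdiv_lt_0_compat; lra.
    - exists N. specialize (HN N (le_n N)).
      assert (Hp : 0 <= q ^ N) by (apply pow_le; lra).
      rewrite Rabs_right in HN; [|lra].
      assert (K * q ^ N <= (K + 1) * q ^ N) by nra.
      assert ((K + 1) * q ^ N < (K + 1) * (e / (K + 1))) by (apply Rmult_lt_compat_l; lra).
      replace ((K + 1) * (e / (K + 1))) with e in H0 by (field; lra). lra. }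
  destruct (R_complete u) as [l Hl].
  - intros e He. destruct (Hlim (e / 2)) as [N HN]; [lra|].
    exists N. intros n m Hn Hm. unfold Rdist.
    assert (H1 := Hk' N (Nat.sub n N)). assert (H2 := Hk' N (Nat.sub m N)).
    replace (Nat.sub n N + N)%coq_nat with n in H1 by lia.
    replace (Nat.sub m N + N)%coq_nat with m in H2 by lia.
    replace (u n - u m) with ((u n - u N) - (u m - u N)) by ring.
    eapply Rle_lt_trans; [apply Rabs_triang|]. rewrite Rabs_Ropp. lra.
  - exists l. intros n. apply Rle_plus_epsilon; intros e He.
    destruct (Hl e He) as [N HN].
    specialize (HN (N + n)%coq_nat). unfold Rdist in HN.
    assert (H1 := Hk' n N).
    assert (H2 : Rabs (u (N + n)%coq_nat - l) < e) by (apply HN; lia).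
    replace (l - u n) with (- (u (N + n)%coq_nat - l) + (u (N + n)%coq_nat - u n)) by ring.
    eapply Rle_trans; [apply Rabs_triang|]. rewrite Rabs_Ropp. lra.
Qed.

Lemma rsum_ext (n : nat) (F G : nat -> R) :
  (forall i, (i < n)%coq_nat -> F i = G i) -> rsum n F = rsum n G.
Proof.
  induction n as [|n IH]; intros H; simpl; [easy|].
  rewrite IH; [|intros; apply H; lia]. rewrite (H n); [easy|lia].
Qed.

Lemma rsum_sub (n : nat) (F G : nat -> R) :
  rsum n (fun i => F i - G i) = rsum n F - rsum n G.
Proof. induction n as [|n IH]; simpl; [ring|rewrite IH; ring]. Qed.

Lemma rsum_scal (n : nat) (c : R) (F : nat -> R) :
  rsum n (fun i => c * F i) = c * rsum n F.
Proof. induction n as [|n IH]; simpl; [ring|rewrite IH; ring]. Qed.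

Lemma rsum_const (n : nat) (c : R) : rsum n (fun=> c) = INR n * c.
Proof. induction n as [|n IH]; [simpl; ring|]. rewrite S_INR; simpl; rewrite IH; ring. Qed.

Lemma rsum_telescope (n : nat) (p : nat -> R) :
  rsum n (fun i => p (S i) - p i) = p n - p O.
Proof. induction n as [|n IH]; simpl; [ring|rewrite IH; ring]. Qed.

Lemma rsum_abs_le (n : nat) (F G : nat -> R) :
  (forall i, (i < n)%coq_nat -> Rabs (F i) <= G i) -> Rabs (rsum n F) <= rsum n G.
Proof.
  induction n as [|n IH]; intros H; simpl; [rewrite Rabs_R0; lra|].
  eapply Rle_trans; [apply Rabs_triang|].
  apply Rplus_le_compat; [apply IH; intros; apply H; lia|apply H; lia].
Qed.

Lemma rsum_split (k m : nat) (F : nat -> R) :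
  rsum (k + m)%coq_nat F = rsum k F + rsum m (fun i => F (k + i)%coq_nat).
Proof.
  induction m as [|m IH]; simpl; [rewrite Nat.add_0_r; ring|].
  rewrite Nat.add_succ_r; simpl; rewrite IH; ring.
Qed.

Lemma rsum_pairs (n : nat) (F : nat -> R) :
  rsum (2 * n)%coq_nat F = rsum n (fun i => F (2 * i)%coq_nat + F (S (2 * i)%coq_nat)).
Proof.
  induction n as [|n IH]; [easy|].
  replace (2 * S n)%coq_nat with (S (S (2 * n)%coq_nat)) by lia.
  simpl rsum at 1. rewrite IH. simpl. ring.
Qed.

(** * Discrete sewing *)

(** The solution K of K = 2 K (1/2)^theta + 2: two halves plus two defects, one at each end of the
    middle cell. *)
Definition sewing_const (theta : R) : R := 2 / (1 - 2 * rpow (1 / 2) theta).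

Lemma two_rpow_half (theta : R) : 1 < theta -> 2 * rpow (1 / 2) theta < 1.
Proof.
  intros Ht. rewrite rpow_pos; [|lra].
  replace theta with (1 + (theta - 1)) by ring.
  rewrite Rpower_plus Rpower_1; [|lra].
  assert (Rpower (1 / 2) (theta - 1) < 1); [|lra].
  apply Rlt_le_trans with (exp 0); [|rewrite exp_0; lra].
  apply exp_increasing.
  assert (ln (1 / 2) < 0) by (generalize (ln_increasing (1 / 2) 1); rewrite ln_1; lra).
  nra.
Qed.

Lemma sewing_const_ge0 (theta : R) : 1 < theta -> 0 <= sewing_const theta.
Proof.
  intros Ht. apply Rdiv_ge0; [lra|]. generalize (two_rpow_half theta Ht); lra.
Qed.

Lemma discrete_ivt (n : nat) (p : nat -> R) (c : R) :
  p O <= c -> c <= p (S n) -> exists k, (k <= n)%coq_nat /\ p k <= c <= p (S k).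
Proof.
  induction n as [|n IH]; intros H0 Hn; [exists O; split; [lia|lra]|].
  destruct (Rle_dec c (p (S n))) as [H|H].
  - destruct IH as [k [Hk Hc]]; [lra|lra|]. exists k; split; [lia|lra].
  - exists (S n); split; [lia|lra].
Qed.

Lemma monotone_le (n : nat) (p : nat -> R) :
  (forall i, (i < n)%coq_nat -> p i <= p (S i)) ->
  forall i j, (i <= j)%coq_nat -> (j <= n)%coq_nat -> p i <= p j.
Proof.
  intros Hp i j Hij; induction Hij as [|j Hij IH]; intros Hj; [lra|].
  apply Rle_trans with (p j); [apply IH; lia|apply Hp; lia].
Qed.

(* Splitting at the cell that contains the midpoint leaves two pieces of at most half the length, so the constant contracts by [2 * (1/2)^theta < 1]; no point has to be removed one at a time. *)
Lemma sewing_bound (theta : R) (X : R -> R -> R) (a b C : R) :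
  1 < theta -> 0 <= C ->
  (forall u, a <= u <= b -> X u u = 0) ->
  (forall u v z, a <= u -> u <= v -> v <= z -> z <= b ->
     Rabs (X u z - X u v - X v z) <= C * rpow (z - u) theta) ->
  forall (n : nat) (p : nat -> R),
    (forall i, (i < n)%coq_nat -> p i <= p (S i)) -> a <= p O -> p n <= b ->
    Rabs (rsum n (fun k => X (p k) (p (S k))) - X (p O) (p n))
      <= sewing_const theta * C * rpow (p n - p O) theta.
Proof.
  intros Ht HC X0 X3 n. induction n as [n IH] using Wf_nat.lt_wf_ind. intros p Hp Ha Hb.
  assert (HK := sewing_const_ge0 theta Ht).
  destruct n as [|n].
  { simpl. rewrite X0; [|lra]. rewrite !Rminus_diag rpow_0 Rabs_R0. lra. }
  assert (Hmon := monotone_le _ _ Hp).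
  assert (H0n : p O <= p (S n)) by (apply Hmon; lia).
  destruct (discrete_ivt n p ((p O + p (S n)) / 2)) as [k [Hk Hmid]]; [lra|lra|].
  assert (Hn : S n = (k + S (Nat.sub n k))%coq_nat) by lia.
  assert (H0k : p O <= p k) by (apply Hmon; lia).
  assert (Hkn : p (S k) <= p (S n)) by (apply Hmon; lia).
  assert (Hkk : p k <= p (S k)) by (apply Hp; lia).
  assert (IH1 := IH k (ltac:(lia)) p (fun i Hi => Hp i (ltac:(lia))) Ha (ltac:(lra))).
  assert (IH2 := IH (Nat.sub n k) (ltac:(lia)) (fun i => p (S k + i)%coq_nat)).
  cbv beta in IH2.
  replace (S k + (Nat.sub n k))%coq_nat with (S n) in IH2 by lia.
  replace (S k + 0)%coq_nat with (S k) in IH2 by lia.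
  specialize (IH2 (fun i Hi => ltac:(rewrite Nat.add_succ_r; apply Hp; lia)) (ltac:(lra)) Hb).
  assert (Hsplit : rsum (S n) (fun k => X (p k) (p (S k))) =
    rsum k (fun k => X (p k) (p (S k))) + (X (p k) (p (S k)) +
    rsum (Nat.sub n k) (fun i => X (p (S k + i)%coq_nat) (p (S k + S i)%coq_nat)))).
  { rewrite {1}Hn rsum_split. f_equal.
    replace (S (Nat.sub n k)) with (1 + (Nat.sub n k))%coq_nat by lia.
    rewrite rsum_split. simpl rsum at 1. rewrite Nat.add_0_r Rplus_0_l. f_equal.
    apply rsum_ext; intros i Hi.
    replace (k + (1 + i)%coq_nat)%coq_nat with (S k + i)%coq_nat by lia.
    by replace (S (S k + i)%coq_nat) with (S k + S i)%coq_nat by lia. }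
  rewrite Hsplit {Hsplit}.
  (* Two defects join the three pieces: at [p k] on the whole interval, and at [p (S k)] on what
     lies to the right of [p k]. *)
  assert (Hx1 := X3 (p O) (p k) (p (S n)) Ha H0k (ltac:(lra)) Hb).
  assert (Hx2 := X3 (p k) (p (S k)) (p (S n)) (ltac:(lra)) Hkk Hkn Hb).
  set (L := p (S n) - p O) in *.
  assert (Hhalf : forall c, c <= 1 / 2 * L -> rpow c theta <= rpow (1 / 2) theta * rpow L theta).
  { intros c Hc. rewrite <- rpow_mul; [|lra|unfold L; lra]. apply rpow_le; lra. }
  assert (Hr1 := Hhalf (p k - p O) (ltac:(unfold L; lra))).
  assert (Hr2 := Hhalf (p (S n) - p (S k)) (ltac:(unfold L; lra))).
  assert (Hr3 : rpow (p (S n) - p k) theta <= rpow L theta) by (apply rpow_le; unfold L; lra).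
  assert (HKC : 0 <= sewing_const theta * C) by (apply Rmult_le_pos; lra).
  apply (Rmult_le_compat_l _ _ _ HKC) in Hr1.
  apply (Rmult_le_compat_l _ _ _ HKC) in Hr2.
  apply (Rmult_le_compat_l _ _ _ HC) in Hr3.
  assert (HKeq : sewing_const theta * C * rpow L theta =
    sewing_const theta * C * (rpow (1 / 2) theta * rpow L theta) +
    sewing_const theta * C * (rpow (1 / 2) theta * rpow L theta) +
    C * rpow L theta + C * rpow L theta).
  { assert (H2 := two_rpow_half theta Ht). unfold sewing_const. field. lra. }
  rewrite HKeq. abs_lra.
Qed.

(** * Young integrals of real functions *)

(** The case s = t is harmless since [rpow 0 alpha] is 0, and it admits partitions with degenerate
    cells. *)
Definition holder_on (y : R -> R) (alpha C a b : R) : Prop :=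
  forall s t, a <= s -> s <= t -> t <= b -> Rabs (y t - y s) <= C * rpow (t - s) alpha.

Lemma holder_on_sub (y : R -> R) (alpha C a b a' b' : R) :
  a <= a' -> b' <= b -> holder_on y alpha C a b -> holder_on y alpha C a' b'.
Proof. intros Ha Hb H s t Hs Hst Ht; apply H; lra. Qed.

Lemma holder_on_id (a b : R) : holder_on (fun s => s) 1 1 a b.
Proof. intros s t _ Hst _. rewrite rpow_1r; [|lra]. rewrite Rabs_right; lra. Qed.

Definition germ (y w : R -> R) (s t : R) : R := y s * (w t - w s).

(** The points u and v are independent, so that one bound covers the germ defect (u = v), an
    arbitrary tag (v = s) and a grid cell cut by an endpoint. *)
Lemma holder_prod_le (y w : R -> R) (alpha nu Cy Cw a b s u v t : R) :
  0 <= Cy -> 0 <= Cw -> 0 <= alpha -> 0 <= nu ->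
  holder_on y alpha Cy a b -> holder_on w nu Cw a b ->
  a <= s -> t <= b -> s <= u -> u <= t -> s <= v -> v <= t ->
  Rabs ((y u - y s) * (w t - w v)) <= Cy * Cw * rpow (t - s) (alpha + nu).
Proof.
  intros HCy HCw Ha Hn Hy Hw Has Htb Hsu Hut Hsv Hvt.
  rewrite Rabs_mult rpow_add; [|lra].
  replace (Cy * Cw * (rpow (t - s) alpha * rpow (t - s) nu))
    with ((Cy * rpow (t - s) alpha) * (Cw * rpow (t - s) nu)) by ring.
  apply Rmult_le_compat; try apply Rabs_pos.
  - eapply Rle_trans; [apply Hy; lra|].
    apply Rmult_le_compat_l; [lra|apply rpow_le; lra].
  - eapply Rle_trans; [apply Hw; lra|].
    apply Rmult_le_compat_l; [lra|apply rpow_le; lra].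
Qed.

Lemma germ_defect (y w : R -> R) (alpha nu Cy Cw a b u v z : R) :
  0 <= Cy -> 0 <= Cw -> 0 <= alpha -> 0 <= nu ->
  holder_on y alpha Cy a b -> holder_on w nu Cw a b ->
  a <= u -> u <= v -> v <= z -> z <= b ->
  Rabs (germ y w u z - germ y w u v - germ y w v z) <= Cy * Cw * rpow (z - u) (alpha + nu).
Proof.
  intros HCy HCw Ha Hn Hy Hw Hu Huv Hvz Hz.
  replace (germ y w u z - germ y w u v - germ y w v z)
    with (- ((y v - y u) * (w z - w v))) by (unfold germ; ring).
  rewrite Rabs_Ropp. apply (holder_prod_le y w alpha nu Cy Cw a b); try assumption; lra.
Qed.

Lemma germ_sewing (y w : R -> R) (alpha nu Cy Cw a b : R) (n : nat) (p : nat -> R) :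
  0 <= Cy -> 0 <= Cw -> 0 <= alpha -> 0 <= nu -> 1 < alpha + nu ->
  holder_on y alpha Cy a b -> holder_on w nu Cw a b ->
  (forall i, (i < n)%coq_nat -> p i <= p (S i)) -> a <= p O -> p n <= b ->
  Rabs (rsum n (fun k => germ y w (p k) (p (S k))) - germ y w (p O) (p n))
    <= sewing_const (alpha + nu) * (Cy * Cw) * rpow (p n - p O) (alpha + nu).
Proof.
  intros HCy HCw Ha Hn Han Hy Hw Hp H0 H1.
  apply (sewing_bound (alpha + nu) (germ y w) a b); try assumption.
  - apply Rmult_le_pos; lra.
  - intros u _; unfold germ; ring.
  - intros; apply (germ_defect y w alpha nu Cy Cw a b); assumption.
Qed.

(** One fixed grid, truncated at t: cells beyond t degenerate and contribute 0. Sums for different t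
    can thus be compared cell by cell. *)
Definition grid_sum (y w : R -> R) (N : nat) (h t : R) : R :=
  rsum N (fun k => germ y w (Rmin t (INR k * h)) (Rmin t (INR (S k) * h))).

Lemma clamped_cell (t h T : R) (k : nat) :
  0 <= t <= T -> 0 <= h ->
  0 <= Rmin t (INR k * h) /\ Rmin t (INR k * h) <= Rmin t (INR (S k) * h) /\
  Rmin t (INR (S k) * h) <= T /\ Rmin t (INR (S k) * h) - Rmin t (INR k * h) <= h.
Proof.
  intros Ht Hh. rewrite S_INR.
  assert (0 <= INR k * h) by (apply Rmult_le_pos; [apply pos_INR|lra]).
  unfold Rmin; destruct (Rle_dec t (INR k * h)), (Rle_dec t ((INR k + 1) * h)); simpl; lra.
Qed.

Lemma rsum_abs_le_const (n : nat) (F : nat -> R) (c : R) :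
  (forall i, (i < n)%coq_nat -> Rabs (F i) <= c) -> Rabs (rsum n F) <= INR n * c.
Proof. intros H. rewrite <- rsum_const. apply rsum_abs_le; assumption. Qed.

(** Halving a cell costs one germ defect. If N h = T, the total is of order h^(alpha + nu - 1),
    hence summable along dyadic grids. *)
Lemma grid_sum_refine (y w : R -> R) (alpha nu Cy Cw T h t : R) (N : nat) :
  0 <= Cy -> 0 <= Cw -> 0 <= alpha -> 0 <= nu ->
  holder_on y alpha Cy 0 T -> holder_on w nu Cw 0 T -> 0 <= t <= T -> 0 <= h ->
  Rabs (grid_sum y w (2 * N)%coq_nat (h / 2) t - grid_sum y w N h t)
    <= INR N * (Cy * Cw * rpow h (alpha + nu)).
Proof.
  intros HCy HCw Ha Hn Hy Hw Ht Hh.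
  unfold grid_sum. rewrite rsum_pairs -rsum_sub.
  apply rsum_abs_le_const; intros k _.
  assert (E0 : INR (2 * k)%coq_nat * (h / 2) = INR k * h) by (rewrite mult_INR; simpl; field).
  assert (E2 : INR (S (S (2 * k)%coq_nat)) * (h / 2) = INR (S k) * h)
    by (rewrite !S_INR mult_INR; simpl; field).
  destruct (clamped_cell t h T k Ht Hh) as [H1 [H2 [H3 H4]]].
  destruct (clamped_cell t (h / 2) T (2 * k)%coq_nat Ht (ltac:(lra))) as [H5 [H6 _]].
  destruct (clamped_cell t (h / 2) T (S (2 * k)%coq_nat) Ht (ltac:(lra))) as [_ [H7 _]].
  rewrite E0 in H6. rewrite E2 in H7. rewrite E0 E2.
  set (u := Rmin t (INR k * h)) in *. set (z := Rmin t (INR (S k) * h)) in *.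
  set (v := Rmin t (INR (S (2 * k)%coq_nat) * (h / 2))) in *.
  replace (germ y w u v + germ y w v z - germ y w u z)
    with (- (germ y w u z - germ y w u v - germ y w v z)) by ring.
  rewrite Rabs_Ropp.
  eapply Rle_trans; [apply (germ_defect y w alpha nu Cy Cw 0 T); assumption|].
  apply Rmult_le_compat_l; [apply Rmult_le_pos; lra|apply rpow_le; lra].
Qed.

(* Cells on one side of [s] contribute no error; the cell that contains [s] contributes a Hölder product. *)
Lemma grid_sum_increment (y w : R -> R) (alpha nu Cy Cw T h s t : R) (N : nat) :
  0 <= Cy -> 0 <= Cw -> 0 <= alpha -> 0 <= nu -> 1 < alpha + nu ->
  holder_on y alpha Cy 0 T -> holder_on w nu Cw 0 T ->
  0 <= s -> s <= t -> t <= T -> 0 <= h -> INR N * h = T ->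
  Rabs (grid_sum y w N h t - grid_sum y w N h s - germ y w s t)
    <= sewing_const (alpha + nu) * (Cy * Cw) * rpow (t - s) (alpha + nu)
       + INR N * (Cy * Cw * rpow h (alpha + nu)).
Proof.
  intros HCy HCw Ha Hn Han Hy Hw Hs Hst Ht Hh HN.
  (* Clamping the grid to [s, t] gives a partition from s to t, to which discrete sewing applies. *)
  set (q := fun k : nat => Rmax s (Rmin t (INR k * h))).
  assert (Hq0 : q O = s).
  { unfold q; simpl. rewrite Rmult_0_l Rmin_right; [|lra]. apply Rmax_left; lra. }
  assert (HqN : q N = t).
  { unfold q. rewrite HN Rmin_left; [|lra]. apply Rmax_right; lra. }
  assert (Hq : forall i, (i < N)%coq_nat -> q i <= q (S i)).
  { intros i _. unfold q. apply Rle_max_compat_l.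
    destruct (clamped_cell t h T i (ltac:(lra)) Hh); tauto. }
  assert (Hsew := germ_sewing y w alpha nu Cy Cw 0 T N q HCy HCw Ha Hn Han Hy Hw Hq
    (ltac:(lra)) (ltac:(lra))).
  rewrite Hq0 HqN in Hsew.
  assert (Hdiff : Rabs (grid_sum y w N h t - grid_sum y w N h s -
     rsum N (fun k => germ y w (q k) (q (S k)))) <= INR N * (Cy * Cw * rpow h (alpha + nu))).
  { unfold grid_sum. rewrite <- !rsum_sub.
    apply rsum_abs_le_const; intros k _.
    assert (H0 : 0 <= Cy * Cw * rpow h (alpha + nu))
      by (apply Rmult_le_pos; [apply Rmult_le_pos; lra|apply rpow_ge0]).
    assert (Hk : 0 <= INR k * h) by (apply Rmult_le_pos; [apply pos_INR|lra]).
    assert (HSk : INR (S k) * h = INR k * h + h) by (rewrite S_INR; ring).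
    unfold q. rewrite HSk. set (c := INR k * h) in *.
    destruct (Rle_dec (c + h) s) as [H1|H1]; [|destruct (Rle_dec s c) as [H2|H2]].
    - rewrite !(Rmin_right t) ?(Rmin_right s) ?(Rmax_left s); try lra.
      match goal with |- Rabs ?e <= _ => replace e with 0 by (unfold germ; ring) end.
      rewrite Rabs_R0; lra.
    - rewrite !(Rmin_left s); [|lra|lra].
      rewrite !(Rmax_right s); try (apply Rmin_glb; lra).
      match goal with |- Rabs ?e <= _ => replace e with 0 by (unfold germ; ring) end.
      rewrite Rabs_R0; lra.
    - rewrite (Rmin_right t c) ?(Rmin_right s c) ?(Rmin_left s (c + h)) ?(Rmax_left s c); try lra.
      rewrite (Rmax_right s); [|apply Rmin_glb; lra].
      set (e := Rmin t (c + h)).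
      assert (He : s <= e) by (apply Rmin_glb; lra).
      assert (He1 : e <= t) by apply Rmin_l.
      assert (He2 : e <= c + h) by apply Rmin_r.
      replace (germ y w c e - germ y w c s - germ y w s e)
        with (- ((y s - y c) * (w e - w s))) by (unfold germ; ring).
      rewrite Rabs_Ropp.
      eapply Rle_trans;
        [apply (holder_prod_le y w alpha nu Cy Cw 0 T); try assumption; lra|].
      apply Rmult_le_compat_l; [apply Rmult_le_pos; lra|apply rpow_le; lra]. }
  abs_lra.
Qed.

Lemma pow_small (q eps : R) : 0 <= q < 1 -> 0 < eps -> exists n, q ^ n <= eps.
Proof.
  intros Hq He. destruct (pow_lt_1_zero q) with (y := eps) as [N HN]; [rewrite Rabs_right; lra|lra|].
  exists N. specialize (HN N (le_n N)). generalize (Rle_abs (q ^ N)); lra.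
Qed.

Lemma rpow_pow (a p : R) (n : nat) : 0 <= a -> rpow (a ^ n) p = rpow a p ^ n.
Proof.
  intros Ha. induction n as [|n IH]; simpl; [apply rpow_1l|].
  rewrite rpow_mul; [|lra|apply pow_le; lra]. by rewrite IH.
Qed.

(** The primitive is the pointwise limit of dyadic grid sums. Its defect bound is inherited from
    [grid_sum_increment], where the mesh term tends to 0. *)
Lemma young_primitive (y w : R -> R) (alpha nu Cy Cw T : R) :
  0 <= Cy -> 0 <= Cw -> 0 <= alpha -> 0 <= nu -> 1 < alpha + nu -> 0 <= T ->
  holder_on y alpha Cy 0 T -> holder_on w nu Cw 0 T ->
  exists J : R -> R, forall s t, 0 <= s -> s <= t -> t <= T ->
    Rabs (J t - J s - germ y w s t)
      <= sewing_const (alpha + nu) * (Cy * Cw) * rpow (t - s) (alpha + nu).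
Proof.
  intros HCy HCw Ha Hn Han HT Hy Hw.
  set (q := 2 * rpow (1 / 2) (alpha + nu)).
  assert (Hq : 0 <= q < 1).
  { split; [generalize (rpow_ge0 (1 / 2) (alpha + nu)); unfold q; lra|].
    apply two_rpow_half; lra. }
  set (c := Cy * Cw * rpow T (alpha + nu)).
  set (N := fun n => Nat.pow 2 n). set (h := fun n : nat => T * (1 / 2) ^ n).
  assert (Hh : forall n, 0 <= h n) by (intros n; apply Rmult_le_pos; [lra|apply pow_le; lra]).
  assert (HNh : forall n, INR (N n) * h n = T).
  { intros n. unfold N, h. rewrite pow_INR.
    replace (INR 2 ^ n * (T * (1 / 2) ^ n)) with (T * (INR 2 ^ n * (1 / 2) ^ n)) by ring.
    rewrite <- Rpow_mult_distr. replace (INR 2 * (1 / 2)) with 1 by (simpl; field).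
    rewrite pow1; ring. }
  (* Doubling the number of cells and halving their length multiplies the mesh error by 2
     (1/2)^(alpha + nu), which is q < 1. *)
  assert (Herr : forall n, INR (N n) * (Cy * Cw * rpow (h n) (alpha + nu)) = c * q ^ n).
  { intros n. unfold h, N, c, q. rewrite rpow_mul; [|lra|apply pow_le; lra].
    rewrite rpow_pow; [|lra]. rewrite pow_INR Rpow_mult_distr.
    replace (INR 2) with 2 by (simpl; ring). ring. }
  assert (Hlim : forall t, exists l, 0 <= t <= T ->
    forall n, Rabs (l - grid_sum y w (N n) (h n) t) <= c / (1 - q) * q ^ n).
  { intros t. destruct (excluded_middle_informative (0 <= t <= T)) as [Ht|Ht].
    - destruct (geometric_limit (fun n => grid_sum y w (N n) (h n) t) c q Hq) as [l Hl].
      + intros n. rewrite <- Herr.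
        replace (h (S n)) with (h n / 2) by (unfold h; simpl; field).
        apply (grid_sum_refine y w alpha nu Cy Cw T); auto.
      + exists l; auto.
    - exists 0; tauto. }
  (* The range condition sits inside the predicate, so the choice is made for every real t and is
     meaningful on [0, T]. *)
  set (J := fun t => epsilon (inhabits 0) (fun l => 0 <= t <= T ->
    forall n, Rabs (l - grid_sum y w (N n) (h n) t) <= c / (1 - q) * q ^ n)).
  assert (HJ : forall t, 0 <= t <= T ->
    forall n, Rabs (J t - grid_sum y w (N n) (h n) t) <= c / (1 - q) * q ^ n).
  { intros t. apply (epsilon_spec (inhabits 0) _ (Hlim t)). }
  exists J. intros s t Hs Hst Ht.
  apply (le_of_all_eps _ _ (2 * (c / (1 - q)) + c)); intros eps He.
  destruct (pow_small q eps Hq He) as [n Hqn].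
  assert (H1 := HJ s (ltac:(lra)) n). assert (H2 := HJ t (ltac:(lra)) n).
  assert (H3 := grid_sum_increment y w alpha nu Cy Cw T (h n) s t (N n)
    HCy HCw Ha Hn Han Hy Hw Hs Hst Ht (Hh n) (HNh n)).
  rewrite Herr in H3.
  assert (Hc : 0 <= c) by (apply Rmult_le_pos; [apply Rmult_le_pos; lra|apply rpow_ge0]).
  assert (Hc' : 0 <= c / (1 - q)) by (apply Rdiv_ge0; lra).
  assert (c / (1 - q) * q ^ n <= c / (1 - q) * eps) by (apply Rmult_le_compat_l; lra).
  assert (c * q ^ n <= c * eps) by (apply Rmult_le_compat_l; lra).
  abs_lra.
Qed.

(** * Scalar Riemann-Stieltjes limits: existence, estimates and uniqueness *)

Definition RS_scalar (y w : R -> R) (a b I : R) : Prop :=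
  forall eps, 0 < eps -> exists m, 0 < m /\
    forall (n : nat) (p q : nat -> R),
      p O = a -> p n = b ->
      (forall i, (i < n)%coq_nat -> p i < p (S i)) ->
      (forall i, (i < n)%coq_nat -> p (S i) - p i < m) ->
      (forall i, (i < n)%coq_nat -> p i <= q i <= p (S i)) ->
      Rabs (rsum n (fun i => y (q i) * (w (p (S i)) - w (p i))) - I) < eps.

(** On a cell of length l < m, tag and germ errors total at most K' l^(alpha + nu) <= K' m^(alpha +
    nu - 1) l. The factors l telescope to b - a and the power of m is small. *)
Lemma RS_scalar_of_primitive (y w J : R -> R) (alpha nu Cy Cw K a b : R) :
  0 <= Cy -> 0 <= Cw -> 0 <= alpha -> 0 <= nu -> 1 < alpha + nu -> 0 <= K -> a <= b ->
  holder_on y alpha Cy a b -> holder_on w nu Cw a b ->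
  (forall s t, a <= s -> s <= t -> t <= b ->
     Rabs (J t - J s - germ y w s t) <= K * rpow (t - s) (alpha + nu)) ->
  RS_scalar y w a b (J b - J a).
Proof.
  intros HCy HCw Ha Hn Han HK Hab Hy Hw HJ eps He.
  set (K' := Cy * Cw + K).
  assert (HK' : 0 <= K') by (generalize (Rmult_le_pos _ _ HCy HCw); unfold K'; lra).
  (* The added 1 keeps the divisor positive when K' (b - a) vanishes. *)
  assert (Hden : 0 < K' * (b - a) + 1) by (generalize (Rmult_le_pos K' (b - a)); lra).
  destruct (rpow_small (alpha + nu - 1) (eps / (K' * (b - a) + 1))) as [m [Hm Hme]];
    [lra|apply Rdiv_lt_0_compat; lra|].
  exists m; split; [lra|]. intros n p q Hp0 Hpn Hp Hmesh Hq.
  assert (Hmon := monotone_le n p (fun i Hi => Rlt_le _ _ (Hp i Hi))).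
  replace (J b - J a) with (rsum n (fun i => J (p (S i)) - J (p i)))
    by (rewrite (rsum_telescope n (fun i => J (p i))) Hp0 Hpn; easy).
  rewrite <- rsum_sub.
  eapply Rle_lt_trans.
  - apply rsum_abs_le with (G := fun i => K' * rpow m (alpha + nu - 1) * (p (S i) - p i)).
    intros i Hi.
    assert (Hpi := Hp i Hi). assert (Hqi := Hq i Hi). assert (Hmi := Hmesh i Hi).
    assert (a <= p i) by (rewrite <- Hp0; apply Hmon; lia).
    assert (p (S i) <= b) by (rewrite <- Hpn; apply Hmon; lia).
    assert (H1 := HJ (p i) (p (S i)) (ltac:(lra)) (ltac:(lra)) (ltac:(lra))).
    assert (H2 := holder_prod_le y w alpha nu Cy Cw a b (p i) (q i) (p i) (p (S i))
      HCy HCw Ha Hn Hy Hw (ltac:(lra)) (ltac:(lra)) (ltac:(lra)) (ltac:(lra)) (ltac:(lra)) (ltac:(lra))).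
    assert (H3 := rpow_weaken (p (S i) - p i) m (alpha + nu) 1 (ltac:(lra)) (ltac:(lra)) (ltac:(lra))).
    rewrite rpow_1r in H3; [|lra].
    apply (Rmult_le_compat_l K' _ _ HK') in H3.
    rewrite Rmult_assoc. eapply Rle_trans; [|exact H3].
    unfold K'. unfold germ in H1.
    replace (y (q i) * (w (p (S i)) - w (p i)) - (J (p (S i)) - J (p i)))
      with ((y (q i) - y (p i)) * (w (p (S i)) - w (p i))
        - (J (p (S i)) - J (p i) - y (p i) * (w (p (S i)) - w (p i)))) by ring.
    abs_lra.
  - rewrite rsum_scal rsum_telescope Hp0 Hpn.
    apply Rle_lt_trans with (K' * (b - a) * (eps / (K' * (b - a) + 1))).
    + replace (K' * rpow m (alpha + nu - 1) * (b - a))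
        with (K' * (b - a) * rpow m (alpha + nu - 1)) by ring.
      apply Rmult_le_compat_l; [apply Rmult_le_pos; lra|exact Hme].
    + apply Rlt_le_trans with ((K' * (b - a) + 1) * (eps / (K' * (b - a) + 1))).
      * apply Rmult_lt_compat_r; [apply Rdiv_lt_0_compat; lra|lra].
      * apply Req_le; field; lra.
Qed.

(** A single primitive serves all subintervals, which builds additivity in the endpoints into the
    construction. *)
Lemma young_exists (y w : R -> R) (alpha nu Cy Cw T : R) :
  0 <= Cy -> 0 <= Cw -> 0 <= alpha -> 0 <= nu -> 1 < alpha + nu -> 0 <= T ->
  holder_on y alpha Cy 0 T -> holder_on w nu Cw 0 T ->
  exists J : R -> R, forall s t, 0 <= s -> s <= t -> t <= T ->
    RS_scalar y w s t (J t - J s).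
Proof.
  intros HCy HCw Ha Hn Han HT Hy Hw.
  destruct (young_primitive y w alpha nu Cy Cw T) as [J HJ]; try assumption.
  exists J. intros s t Hs Hst Ht.
  apply (RS_scalar_of_primitive y w J alpha nu Cy Cw (sewing_const (alpha + nu) * (Cy * Cw)));
    try assumption.
  - apply Rmult_le_pos; [apply sewing_const_ge0; lra|apply Rmult_le_pos; lra].
  - apply (holder_on_sub y alpha Cy 0 T); assumption.
  - apply (holder_on_sub w nu Cw 0 T); assumption.
  - intros u v Hu Huv Hv; apply HJ; lra.
Qed.

(** [RS_scalar] determines its value only because such partitions exist for every mesh. *)
Lemma fine_partition (a b m : R) :
  a <= b -> 0 < m -> exists (n : nat) (p : nat -> R),
    p O = a /\ p n = b /\ (forall i, (i < n)%coq_nat -> p i < p (S i)) /\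
    (forall i, (i < n)%coq_nat -> p (S i) - p i < m).
Proof.
  (* Cells must be strictly increasing, so a degenerate interval gets the partition with no cell. *)
  intros [Hab|Hab] Hm; [|exists O, (fun=> a); repeat split; [exact Hab|lia|lia]].
  destruct (INR_unbounded ((b - a) / m)) as [n Hn].
  assert (Hq : 0 < (b - a) / m) by (apply Rdiv_lt_0_compat; lra).
  assert (Hn0 : 0 < INR n) by lra.
  assert (Hd : 0 < (b - a) / INR n) by (apply Rdiv_lt_0_compat; lra).
  assert (Hdm : (b - a) / INR n < m).
  { apply (Rmult_lt_reg_r (INR n)); [lra|].
    replace ((b - a) / INR n * INR n) with (b - a) by (field; lra).
    apply (Rmult_lt_compat_r m) in Hn; [|lra].
    replace ((b - a) / m * m) with (b - a) in Hn by (field; lra). lra. }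
  exists n, (fun k => a + INR k * ((b - a) / INR n)).
  split; [simpl; ring|split; [field; lra|]].
  split; intros i _; rewrite S_INR; lra.
Qed.

(** With left endpoints as tags, the Riemann sums are sums of germs, and a bound uniform over
    partitions passes to the limit. *)
Lemma RS_scalar_bound (y w : R -> R) (a b I X c : R) :
  a <= b -> RS_scalar y w a b I ->
  (forall (n : nat) (p : nat -> R), p O = a -> p n = b ->
     (forall i, (i < n)%coq_nat -> p i < p (S i)) ->
     Rabs (rsum n (fun k => germ y w (p k) (p (S k))) - X) <= c) ->
  Rabs (I - X) <= c.
Proof.
  intros Hab HI H. apply (le_of_all_eps _ _ 1); intros eps He.
  destruct (HI eps He) as [m [Hm Hs]].
  destruct (fine_partition a b m Hab Hm) as [n [p [H0 [H1 [H2 H3]]]]].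
  specialize (Hs n p p H0 H1 H2 H3 (fun i Hi => conj (Rle_refl _) (Rlt_le _ _ (H2 i Hi)))).
  specialize (H n p H0 H1 H2). apply Rlt_le in Hs. unfold germ in H. abs_lra.
Qed.

Lemma young_estimate (y w : R -> R) (alpha nu Cy Cw a b I : R) :
  0 <= Cy -> 0 <= Cw -> 0 <= alpha -> 0 <= nu -> 1 < alpha + nu -> a <= b ->
  holder_on y alpha Cy a b -> holder_on w nu Cw a b -> RS_scalar y w a b I ->
  Rabs (I - y a * (w b - w a))
    <= sewing_const (alpha + nu) * (Cy * Cw) * rpow (b - a) (alpha + nu).
Proof.
  intros HCy HCw Ha Hn Han Hab Hy Hw HI.
  apply (RS_scalar_bound y w a b); [assumption|assumption|].
  intros n p H0 H1 Hp. rewrite -H0 -H1.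
  apply (germ_sewing y w alpha nu Cy Cw a b); try assumption; try lra.
  intros i Hi; left; apply Hp; assumption.
Qed.

Lemma riemann_estimate (y : R -> R) (a b I B : R) :
  a <= b -> (forall u, a <= u <= b -> Rabs (y u) <= B) ->
  RS_scalar y (fun s => s) a b I -> Rabs I <= B * (b - a).
Proof.
  intros Hab Hy HI. rewrite <- (Rminus_0_r I).
  apply (RS_scalar_bound y (fun s => s) a b); [assumption|assumption|].
  intros n p H0 H1 Hp. rewrite Rminus_0_r -H0 -H1 -rsum_telescope -rsum_scal.
  assert (Hmon := monotone_le n p (fun i Hi => Rlt_le _ _ (Hp i Hi))).
  apply rsum_abs_le; intros i Hi. unfold germ. rewrite Rabs_mult.
  specialize (Hp i Hi). rewrite (Rabs_right (p (S i) - p i)); [|lra].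
  apply Rmult_le_compat_r; [lra|]. apply Hy.
  split; [rewrite <- H0|rewrite <- H1]; apply Hmon; lia.
Qed.

Lemma RS_scalar_sub (y1 y2 w : R -> R) (a b I1 I2 : R) :
  RS_scalar y1 w a b I1 -> RS_scalar y2 w a b I2 ->
  RS_scalar (fun s => y1 s - y2 s) w a b (I1 - I2).
Proof.
  intros H1 H2 eps He.
  destruct (H1 (eps / 2)) as [m1 [Hm1 K1]]; [lra|].
  destruct (H2 (eps / 2)) as [m2 [Hm2 K2]]; [lra|].
  exists (Rmin m1 m2); split; [apply Rmin_glb_lt; lra|].
  intros n p q P0 Pn Hp Hm Hq.
  specialize (K1 n p q P0 Pn Hp (fun i Hi => Rlt_le_trans _ _ _ (Hm i Hi) (Rmin_l _ _)) Hq).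
  specialize (K2 n p q P0 Pn Hp (fun i Hi => Rlt_le_trans _ _ _ (Hm i Hi) (Rmin_r _ _)) Hq).
  rewrite (rsum_ext n _ (fun i => y1 (q i) * (w (p (S i)) - w (p i))
    - y2 (q i) * (w (p (S i)) - w (p i)))); [|intros; ring].
  rewrite rsum_sub. apply Rabs_def2 in K1. apply Rabs_def2 in K2. apply Rabs_def1; lra.
Qed.

Lemma RS_scalar_unique (y w : R -> R) (a b I1 I2 : R) :
  a <= b -> RS_scalar y w a b I1 -> RS_scalar y w a b I2 -> I1 = I2.
Proof.
  intros Hab H1 H2. assert (H := RS_scalar_sub _ _ _ _ _ _ _ H1 H2).
  assert (H0 : Rabs (I1 - I2 - 0) <= 0).
  { apply (RS_scalar_bound _ _ _ _ _ _ _ Hab H). intros n p _ _ _.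
    rewrite (rsum_ext n _ (fun=> 0)); [|intros; unfold germ; ring].
    rewrite rsum_const Rmult_0_r Rminus_diag Rabs_R0; lra. }
  abs_lra.
Qed.

(** * Coordinatewise bounds for paths and coefficients *)

Lemma big_Rplus_ge0 (I : Type) (s : seq I) (F : I -> R) :
  (forall i, 0 <= F i) -> 0 <= \big[Rplus/0]_(i <- s) F i.
Proof.
  intros HF; elim: s => [|a s IH]; [rewrite big_nil; lra|].
  rewrite big_cons; generalize (HF a); lra.
Qed.

Lemma big_Rplus_ge_term (I : eqType) (s : seq I) (F : I -> R) (i : I) :
  (forall j, 0 <= F j) -> i \in s -> F i <= \big[Rplus/0]_(j <- s) F j.
Proof.
  intros HF; elim: s => [|a s IH]; [easy|].
  rewrite in_cons big_cons; case/orP => [/eqP ->|Hi].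
  - generalize (big_Rplus_ge0 I s F HF); lra.
  - generalize (IH Hi) (HF a); lra.
Qed.

Lemma big_Rplus_le_const (I : Type) (s : seq I) (F : I -> R) (c : R) :
  (forall j, F j <= c) -> \big[Rplus/0]_(j <- s) F j <= INR (size s) * c.
Proof.
  intros HF; elim: s => [|a s IH]; [rewrite big_nil; simpl; lra|].
  rewrite big_cons. simpl size. rewrite S_INR. generalize (HF a); lra.
Qed.

Lemma vnorm_ge0 {d} (u : Vec d) : 0 <= vnorm u.
Proof. apply sqrt_pos. Qed.

Lemma vnorm_ge_coord {d} (u : Vec d) (i : 'I_d) : Rabs (u i) <= vnorm u.
Proof.
  rewrite -sqrt_Rsqr_abs. apply sqrt_le_1_alt. unfold Rsqr.
  apply (big_Rplus_ge_term _ _ (fun i => u i * u i)); [intros; apply Rle_0_sqr|].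
  apply mem_index_enum.
Qed.

(** The crude constant 1 + d, in place of sqrt d, is polynomial in d and stays positive for d = 0,
    so it can be divided by. *)
Lemma vnorm_le {d} (u : Vec d) (c : R) :
  0 <= c -> (forall i, Rabs (u i) <= c) -> vnorm u <= (1 + INR d) * c.
Proof.
  intros Hc Hu.
  assert (Hd := pos_INR d).
  rewrite -(sqrt_Rsqr ((1 + INR d) * c)); [|apply Rmult_le_pos; lra].
  apply sqrt_le_1_alt.
  apply Rle_trans with (INR (size (index_enum 'I_d)) * (c * c)).
  - apply big_Rplus_le_const; intros i.
    specialize (Hu i). apply Rabs_le_bounds in Hu. nra.
  - replace (size (index_enum 'I_d)) with d
      by (rewrite /index_enum locked_withE -enumT size_enum_ord; easy).
    unfold Rsqr. assert (0 <= c * c) by nra.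
    replace ((1 + INR d) * c * ((1 + INR d) * c))
      with (INR d * (c * c) + (1 + INR d + INR d * INR d) * (c * c)) by ring.
    assert (0 <= (1 + INR d + INR d * INR d) * (c * c)) by (apply Rmult_le_pos; nra). lra.
Qed.

(** The premise 0 <= c covers the default value of [Rsup] on empty or unbounded sets. *)
Lemma Rsup_le (E : R -> Prop) (c : R) : 0 <= c -> (forall a, E a -> a <= c) -> Rsup E <= c.
Proof.
  intros Hc H. unfold Rsup.
  destruct (excluded_middle_informative _) as [H0|H0]; [|exact Hc].
  destruct (completeness E (proj1 H0) (proj2 H0)) as [m Hm]; simpl. apply Hm. exact H.
Qed.

Lemma Rsup_ge0 (E : R -> Prop) : (forall a, E a -> 0 <= a) -> 0 <= Rsup E.
Proof.
  intros H. unfold Rsup.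
  destruct (excluded_middle_informative _) as [[H0 [x Hx]]|H0]; [|lra].
  destruct (completeness E _ _) as [m Hm]; simpl.
  apply Rle_trans with x; [apply H; exact Hx|apply Hm; exact Hx].
Qed.

Lemma Cr_norm_ge0 {r d} (xi : Dr r -> Vec d) : 0 <= Cr_norm xi.
Proof. apply Rsup_ge0; intros a [u ->]; apply vnorm_ge0. Qed.

(** To exploit [Hf] and [Hg], the sup norm has to be bounded from above: it occurs in premises as a
    small or bounded quantity and on the larger side of conclusions. *)
Lemma Cr_norm_le {r d} (xi : Dr r -> Vec d) (c : R) :
  0 <= c -> (forall u i, Rabs (xi u i) <= c) -> Cr_norm xi <= (1 + INR d) * c.
Proof.
  intros Hc H. apply Rsup_le.
  - apply Rmult_le_pos; [generalize (pos_INR d); lra|lra].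
  - intros a [u ->]. apply vnorm_le; auto.
Qed.

Lemma Cr_contP {r d} (xi : Dr r -> Vec d) :
  Cr_cont xi <-> forall u eps, 0 < eps -> exists del, 0 < del /\
    forall v : Dr r, Rabs (proj1_sig v - proj1_sig u) < del ->
      forall i, Rabs (xi v i - xi u i) <= eps.
Proof.
  split; intros H u eps He.
  - destruct (H u eps He) as [del [Hdel Hv]]. exists del; split; [exact Hdel|].
    intros v Huv i. left. eapply Rle_lt_trans; [|apply (Hv v Huv)].
    apply (vnorm_ge_coord (vsub (xi v) (xi u))).
  - assert (Hd : 0 < 1 + INR d) by (generalize (pos_INR d); lra).
    assert (He' : 0 < eps / (2 * (1 + INR d))) by (apply Rdiv_lt_0_compat; lra).
    destruct (H u _ He') as [del [Hdel Hv]]. exists del; split; [exact Hdel|].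
    intros v Huv. apply Rle_lt_trans with ((1 + INR d) * (eps / (2 * (1 + INR d)))).
    + apply vnorm_le; [lra|apply (Hv v Huv)].
    + replace ((1 + INR d) * (eps / (2 * (1 + INR d)))) with (eps / 2) by (field; lra). lra.
Qed.

(** Common source of continuity for differences, multiples and points on a line. *)
Lemma Cr_cont_dominated {r d} (K : R) (xi h z : Dr r -> Vec d) :
  0 <= K -> Cr_cont xi -> Cr_cont h ->
  (forall u v i, Rabs (z v i - z u i) <= K * (Rabs (xi v i - xi u i) + Rabs (h v i - h u i))) ->
  Cr_cont z.
Proof.
  intros HK Hxi Hh Hz. apply Cr_contP; intros u eps He.
  rewrite -> Cr_contP in Hxi, Hh.
  assert (He' : 0 < eps / (2 * (K + 1))) by (apply Rdiv_lt_0_compat; lra).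
  destruct (Hxi u _ He') as [d1 [Hd1 H1]]. destruct (Hh u _ He') as [d2 [Hd2 H2]].
  exists (Rmin d1 d2); split; [apply Rmin_glb_lt; lra|].
  intros v Hv i.
  specialize (H1 v (Rlt_le_trans _ _ _ Hv (Rmin_l _ _)) i).
  specialize (H2 v (Rlt_le_trans _ _ _ Hv (Rmin_r _ _)) i).
  eapply Rle_trans; [apply Hz|].
  apply Rle_trans with ((K + 1) * (eps / (2 * (K + 1)) + eps / (2 * (K + 1)))).
  - apply Rmult_le_compat; try lra.
    generalize (Rabs_pos (xi v i - xi u i)) (Rabs_pos (h v i - h u i)); lra.
  - apply Req_le; field; lra.
Qed.

Lemma Cr_cont_sub {r d} (xi h : Dr r -> Vec d) :
  Cr_cont xi -> Cr_cont h -> Cr_cont (Cr_sub xi h).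
Proof.
  intros Hxi Hh. apply (Cr_cont_dominated 1 xi h); [lra|assumption|assumption|].
  intros u v i. unfold Cr_sub, vsub.
  replace (xi v i - h v i - (xi u i - h u i)) with ((xi v i - xi u i) - (h v i - h u i)) by ring.
  eapply Rle_trans; [apply Rabs_triang|]. rewrite Rabs_Ropp; lra.
Qed.

Lemma Cr_cont_scal {r d} (c : R) (h : Dr r -> Vec d) : Cr_cont h -> Cr_cont (Cr_scal c h).
Proof.
  intros Hh. apply (Cr_cont_dominated (Rabs c) h h); [apply Rabs_pos|assumption|assumption|].
  intros u v i. unfold Cr_scal, vscal. rewrite -Rmult_minus_distr_l Rabs_mult.
  apply Rmult_le_compat_l; [apply Rabs_pos|].
  generalize (Rabs_pos (h v i - h u i)); lra.
Qed.

Lemma Cr_cont_add_scal {r d} (c : R) (xi h : Dr r -> Vec d) :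
  Cr_cont xi -> Cr_cont h -> Cr_cont (Cr_add xi (Cr_scal c h)).
Proof.
  intros Hxi Hh. apply (Cr_cont_dominated 1 xi (Cr_scal c h));
    [lra|assumption|apply Cr_cont_scal; assumption|].
  intros u v i. unfold Cr_add, vadd. set (z := Cr_scal c h).
  replace (xi v i + z v i - (xi u i + z u i)) with ((xi v i - xi u i) + (z v i - z u i)) by ring.
  rewrite Rmult_1_l. apply Rabs_triang.
Qed.

(** Supplies one mesh that works for all coordinates at once. *)
Lemma finite_min (I : finType) (P : I -> R -> Prop) :
  (forall i m m', 0 < m' -> m' <= m -> P i m -> P i m') ->
  (forall i, exists m, 0 < m /\ P i m) -> exists m, 0 < m /\ forall i, P i m.
Proof.
  intros Hmon H.
  assert (Hs : forall s : seq I, exists m, 0 < m /\ forall i, i \in s -> P i m).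
  { elim => [|a s [m [Hm IH]]]; [exists 1; split; [lra|easy]|].
    destruct (H a) as [m' [Hm' Ha]].
    assert (Hmin : 0 < Rmin m m') by (apply Rmin_glb_lt; lra).
    exists (Rmin m m'); split; [exact Hmin|].
    intros i; rewrite in_cons; case/orP => [/eqP ->|Hi].
    - apply (Hmon a m'); [exact Hmin|apply Rmin_r|exact Ha].
    - apply (Hmon i m); [exact Hmin|apply Rmin_l|apply IH; exact Hi]. }
  destruct (Hs (enum I)) as [m [Hm HP]].
  exists m; split; [exact Hm|]. intros i; apply HP. by rewrite mem_enum.
Qed.

Lemma RS_integral_of_scalar {d} (y : R -> Vec d) (w : R -> R) (a b : R) (I : Vec d) :
  (forall i, RS_scalar (fun s => y s i) w a b (I i)) -> RS_integral y w a b I.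
Proof.
  intros H eps He.
  assert (Hd : 0 < 1 + INR d) by (generalize (pos_INR d); lra).
  assert (He' : 0 < eps / (2 * (1 + INR d))) by (apply Rdiv_lt_0_compat; lra).
  destruct (finite_min _ (fun i m => forall (n : nat) (p q : nat -> R),
      p O = a -> p n = b ->
      (forall i, (i < n)%coq_nat -> p i < p (S i)) ->
      (forall i, (i < n)%coq_nat -> p (S i) - p i < m) ->
      (forall i, (i < n)%coq_nat -> p i <= q i <= p (S i)) ->
      Rabs (rsum n (fun j => y (q j) i * (w (p (S j)) - w (p j))) - I i)
        < eps / (2 * (1 + INR d)))) as [m [Hm HI]].
  - intros i m m' _ Hmm HI n p q H0 H1 Hp Hmesh Hq.
    apply HI; try assumption. intros j Hj; generalize (Hmesh j Hj); lra.
  - intros i; exact (H i _ He').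
  - exists m; split; [exact Hm|]. intros n p q H0 H1 Hp Hmesh Hq.
    apply Rle_lt_trans with ((1 + INR d) * (eps / (2 * (1 + INR d)))).
    + apply vnorm_le; [lra|]. intros i. left. apply HI; assumption.
    + replace ((1 + INR d) * (eps / (2 * (1 + INR d)))) with (eps / 2) by (field; lra). lra.
Qed.

Lemma RS_scalar_of_integral {d} (y : R -> Vec d) (w : R -> R) (a b : R) (I : Vec d) (i : 'I_d) :
  RS_integral y w a b I -> RS_scalar (fun s => y s i) w a b (I i).
Proof.
  intros H eps He. destruct (H eps He) as [m [Hm HI]].
  exists m; split; [exact Hm|]. intros n p q H0 H1 Hp Hmesh Hq.
  eapply Rle_lt_trans; [|apply (HI n p q H0 H1 Hp Hmesh Hq)].
  apply (vnorm_ge_coord (vsub (RS_sum y w n p q) I)).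
Qed.

Definition bounded_by {r d} (M : R) (xi : Dr r -> Vec d) : Prop := forall u i, Rabs (xi u i) <= M.

Lemma Hf_coord {r d} (f : (Dr r -> Vec d) -> Vec d) :
  Hf r f -> exists L, 0 <= L /\ forall xi eta, Cr_cont xi -> Cr_cont eta ->
    forall D, 0 <= D -> bounded_by D (Cr_sub xi eta) ->
    forall i, Rabs (f xi i - f eta i) <= L * D.
Proof.
  intros [Lf HL]. assert (Hd := pos_INR d).
  exists (Rabs Lf * (1 + INR d)); split; [apply Rmult_le_pos; [apply Rabs_pos|lra]|].
  intros xi eta Hxi Heta D HD Hb i.
  eapply Rle_trans; [apply (vnorm_ge_coord (vsub (f xi) (f eta)))|].
  eapply Rle_trans; [apply HL; assumption|].
  rewrite Rmult_assoc. apply Rle_trans with (Rabs Lf * Cr_norm (Cr_sub xi eta)).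
  - apply Rmult_le_compat_r; [apply Cr_norm_ge0|apply Rle_abs].
  - apply Rmult_le_compat_l; [apply Rabs_pos|apply Cr_norm_le; assumption].
Qed.

Lemma line_derivative {r d} (g : (Dr r -> Vec d) -> Vec d)
  (Dg : (Dr r -> Vec d) -> (Dr r -> Vec d) -> Vec d) (xi h : Dr r -> Vec d) (B : R) :
  (forall xi c h, Cr_cont xi -> Cr_cont h -> Dg xi (Cr_scal c h) = vscal c (Dg xi h)) ->
  (forall xi, Cr_cont xi -> forall eps, 0 < eps -> exists rho, 0 < rho /\
     forall h, Cr_cont h -> Cr_norm h < rho ->
       vnorm (vsub (vsub (g (Cr_add xi h)) (g xi)) (Dg xi h)) <= eps * Cr_norm h) ->
  Cr_cont xi -> Cr_cont h -> bounded_by B h -> forall (i : 'I_d) (c : R),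
  derivable_pt_lim (fun c => g (Cr_add xi (Cr_scal c h)) i) c (Dg (Cr_add xi (Cr_scal c h)) h i).
Proof.
  intros Hscal Hfr Hxi Hh HB i c eps He.
  assert (Hd := pos_INR d).
  (* N |k| dominates the norm of k h, and N is positive whatever B is. The tolerance eps / (2 N)
     then yields eps / 2, which makes the final inequality strict. *)
  set (N := (1 + INR d) * (Rabs B + 1)).
  assert (HN : 0 < N) by (apply Rmult_lt_0_compat; generalize (Rabs_pos B); lra).
  set (a := Cr_add xi (Cr_scal c h)).
  assert (Ha : Cr_cont a) by (apply Cr_cont_add_scal; assumption).
  destruct (Hfr a Ha (eps / (2 * N))) as [rho [Hrho Hr]]; [apply Rdiv_lt_0_compat; lra|].
  assert (Hdel : 0 < rho / N) by (apply Rdiv_lt_0_compat; lra).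
  exists (mkposreal _ Hdel). intros k Hk0 Hk; simpl in Hk.
  assert (Hkpos := Rabs_pos_lt k Hk0).
  assert (Hnorm : Cr_norm (Cr_scal k h) <= N * Rabs k).
  { unfold N. rewrite Rmult_assoc. apply Cr_norm_le.
    - apply Rmult_le_pos; generalize (Rabs_pos B); lra.
    - intros u j. unfold Cr_scal, vscal. rewrite Rabs_mult Rmult_comm.
      apply Rmult_le_compat_r; [lra|]. generalize (HB u j) (Rle_abs B); lra. }
  assert (Hlt : Cr_norm (Cr_scal k h) < rho).
  { eapply Rle_lt_trans; [exact Hnorm|].
    apply (Rmult_lt_compat_l N) in Hk; [|lra].
    replace (N * (rho / N)) with rho in Hk by (field; lra). exact Hk. }
  specialize (Hr (Cr_scal k h) (Cr_cont_scal k h Hh) Hlt).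
  replace (Cr_add xi (Cr_scal (c + k) h)) with (Cr_add a (Cr_scal k h))
    by (apply functional_extensionality; intros u; apply functional_extensionality; intros j;
        unfold a, Cr_add, Cr_scal, vadd, vscal; ring).
  rewrite (Hscal a k h Ha Hh) in Hr.
  assert (Hi := vnorm_ge_coord (vsub (vsub (g (Cr_add a (Cr_scal k h))) (g a))
    (vscal k (Dg a h))) i).
  unfold vsub at 1 2, vscal at 1 in Hi.
  set (num := g (Cr_add a (Cr_scal k h)) i - g a i) in *.
  replace (num / k - Dg a h i) with ((num - k * Dg a h i) / k) by (field; exact Hk0).
  unfold Rdiv. rewrite Rabs_mult Rabs_inv.
  apply (Rmult_lt_reg_r (Rabs k)); [exact Hkpos|].
  rewrite Rmult_assoc Rinv_l; [|lra]. rewrite Rmult_1_r.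
  apply Rle_lt_trans with (eps / (2 * N) * (N * Rabs k)).
  - eapply Rle_trans; [exact Hi|]. eapply Rle_trans; [exact Hr|].
    apply Rmult_le_compat_l; [left; apply Rdiv_lt_0_compat; lra|exact Hnorm].
  - replace (eps / (2 * N) * (N * Rabs k)) with (eps * Rabs k / 2) by (field; lra).
    assert (0 < eps * Rabs k) by (apply Rmult_lt_0_compat; lra). lra.
Qed.

(* The mean value theorem is applied to [c |-> g (eta1 + c (xi1 - eta1)) - g (eta2 + c (xi2 - eta2))]. *)
Lemma Hg_coord {r d} (delta : R) (g : (Dr r -> Vec d) -> Vec d) :
  0 <= delta -> Hg r delta g ->
  exists L, 0 <= L /\ forall M, 0 < M -> exists LM, 0 <= LM /\
    forall xi1 eta1 xi2 eta2, Cr_cont xi1 -> Cr_cont eta1 -> Cr_cont xi2 -> Cr_cont eta2 ->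
    bounded_by M xi1 -> bounded_by M eta1 -> bounded_by M xi2 -> bounded_by M eta2 ->
    forall D E P, 0 <= D -> 0 <= E -> 0 <= P ->
    bounded_by D (Cr_sub xi2 eta2) ->
    bounded_by E (Cr_sub (Cr_sub xi1 eta1) (Cr_sub xi2 eta2)) ->
    bounded_by P (Cr_sub xi1 xi2) -> bounded_by P (Cr_sub eta1 eta2) ->
    forall i, Rabs (g xi1 i - g eta1 i - (g xi2 i - g eta2 i)) <= L * E + LM * rpow P delta * D.
Proof.
  intros Hdelta [Dg [Lg [Hadd [Hscal [Hbd [Hfr [_ Hloc]]]]]]].
  assert (Hd := pos_INR d). set (N := 1 + INR d) in *.
  assert (HN : 1 <= N) by (unfold N; lra).
  exists (Rabs Lg * N); split; [apply Rmult_le_pos; [apply Rabs_pos|lra]|].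
  intros M HM. destruct (Hloc (N * M)) as [LM HLM]; [apply Rmult_lt_0_compat; lra|].
  assert (HLM0 : 0 <= Rabs LM * rpow N delta * N).
  { apply Rmult_le_pos; [apply Rmult_le_pos; [apply Rabs_pos|apply rpow_ge0]|lra]. }
  exists (Rabs LM * rpow N delta * N); split; [exact HLM0|].
  intros xi1 eta1 xi2 eta2 Cx1 Ce1 Cx2 Ce2 Bx1 Be1 Bx2 Be2 D E P HD HE HP HbD HbE HbP1 HbP2 i.
  set (h1 := Cr_sub xi1 eta1). set (h2 := Cr_sub xi2 eta2).
  assert (Ch1 : Cr_cont h1) by (apply Cr_cont_sub; assumption).
  assert (Ch2 : Cr_cont h2) by (apply Cr_cont_sub; assumption).
  assert (Bh1 : bounded_by (2 * M) h1).
  { intros u j. assert (H1 := Bx1 u j). assert (H2 := Be1 u j). unfold h1, Cr_sub, vsub. abs_lra. }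
  assert (Bh2 : bounded_by (2 * M) h2).
  { intros u j. assert (H1 := Bx2 u j). assert (H2 := Be2 u j). unfold h2, Cr_sub, vsub. abs_lra. }
  destruct (MVT_cor2
    (fun c => g (Cr_add eta1 (Cr_scal c h1)) i - g (Cr_add eta2 (Cr_scal c h2)) i)
    (fun c => Dg (Cr_add eta1 (Cr_scal c h1)) h1 i - Dg (Cr_add eta2 (Cr_scal c h2)) h2 i)
    0 1 Rlt_0_1) as [c [Hc Hc01]].
  { intros c _. apply derivable_pt_lim_minus;
      [apply (line_derivative g Dg eta1 h1 (2 * M))|apply (line_derivative g Dg eta2 h2 (2 * M))];
      assumption. }
  cbv beta in Hc.
  assert (Hend : forall xi eta : Dr r -> Vec d, Cr_add eta (Cr_scal 1 (Cr_sub xi eta)) = xi /\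
    Cr_add eta (Cr_scal 0 (Cr_sub xi eta)) = eta).
  { intros xi eta; split; apply functional_extensionality; intros u;
      apply functional_extensionality; intros j;
      unfold Cr_add, Cr_scal, Cr_sub, vadd, vscal, vsub; ring. }
  unfold h1 at 1 2, h2 at 1 2 in Hc.
  rewrite (proj1 (Hend xi1 eta1)) (proj2 (Hend xi1 eta1))
    (proj1 (Hend xi2 eta2)) (proj2 (Hend xi2 eta2)) in Hc.
  set (a := Cr_add eta1 (Cr_scal c h1)) in *. set (b := Cr_add eta2 (Cr_scal c h2)) in *.
  assert (Ca : Cr_cont a) by (apply Cr_cont_add_scal; assumption).
  assert (Cb : Cr_cont b) by (apply Cr_cont_add_scal; assumption).
  (* Balls are convex: [a] and [b] stay in the ball of radius M, and a - b is a convex combination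
     of xi1 - xi2 and eta1 - eta2, hence bounded by P. *)
  assert (Hconv : forall s t m : R, Rabs s <= m -> Rabs t <= m -> Rabs (t + c * (s - t)) <= m).
  { intros s t m Hs Ht. apply Rabs_le_bounds in Hs. apply Rabs_le_bounds in Ht.
    apply Rabs_le. nra. }
  assert (Ba : Cr_norm a <= N * M).
  { apply Cr_norm_le; [lra|]. intros u j. apply Hconv; [apply Bx1|apply Be1]. }
  assert (Bb : Cr_norm b <= N * M).
  { apply Cr_norm_le; [lra|]. intros u j. apply Hconv; [apply Bx2|apply Be2]. }
  assert (Bab : Cr_norm (Cr_sub a b) <= N * P).
  { apply Cr_norm_le; [lra|]. intros u j.
    replace (Cr_sub a b u j) with ((eta1 u j - eta2 u j) +
      c * ((xi1 u j - xi2 u j) - (eta1 u j - eta2 u j)))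
      by (unfold a, b, h1, h2, Cr_sub, Cr_add, Cr_scal, vadd, vscal, vsub; ring).
    apply Hconv; [apply HbP1|apply HbP2]. }
  assert (Ch12 : Cr_cont (Cr_sub h1 h2)) by (apply Cr_cont_sub; assumption).
  (* Linearity gives Dg a h1 - Dg b h2 = Dg a (h1 - h2) + (Dg a - Dg b) h2. The first term is
     controlled by the global bound and E, the second by the local Hölder bound, P and D. *)
  assert (Hh1 : h1 = Cr_add (Cr_sub h1 h2) h2).
  { apply functional_extensionality; intros u; apply functional_extensionality; intros j.
    unfold Cr_add, Cr_sub, vadd, vsub; ring. }
  assert (H1 : Rabs (Dg a (Cr_sub h1 h2) i) <= Rabs Lg * N * E).
  { eapply Rle_trans; [apply vnorm_ge_coord|]. eapply Rle_trans; [apply Hbd; assumption|].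
    rewrite Rmult_assoc. apply Rle_trans with (Rabs Lg * Cr_norm (Cr_sub h1 h2)).
    - apply Rmult_le_compat_r; [apply Cr_norm_ge0|apply Rle_abs].
    - apply Rmult_le_compat_l; [apply Rabs_pos|apply Cr_norm_le; assumption]. }
  assert (H2 : Rabs (Dg a h2 i - Dg b h2 i) <= Rabs LM * rpow N delta * N * rpow P delta * D).
  { eapply Rle_trans; [apply (vnorm_ge_coord (vsub (Dg a h2) (Dg b h2)))|].
    eapply Rle_trans; [apply HLM; assumption|].
    replace (Rabs LM * rpow N delta * N * rpow P delta * D)
      with (Rabs LM * (rpow N delta * rpow P delta) * (N * D)) by ring.
    rewrite -rpow_mul; [|lra|lra].
    assert (H0 := rpow_ge0 (Cr_norm (Cr_sub a b)) delta).
    apply Rle_trans with (Rabs LM * rpow (Cr_norm (Cr_sub a b)) delta * Cr_norm h2).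
    - apply Rmult_le_compat_r; [apply Cr_norm_ge0|].
      apply Rmult_le_compat_r; [exact H0|apply Rle_abs].
    - apply Rmult_le_compat; [|apply Cr_norm_ge0| |apply Cr_norm_le; assumption].
      + apply Rmult_le_pos; [apply Rabs_pos|exact H0].
      + apply Rmult_le_compat_l; [apply Rabs_pos|apply rpow_le; lra]. }
  replace (g xi1 i - g eta1 i - (g xi2 i - g eta2 i))
    with (Dg a (Cr_sub h1 h2) i + (Dg a h2 i - Dg b h2 i)).
  - abs_lra.
  - rewrite {1}Hh1 Hadd in Hc; [|assumption|assumption|assumption].
    unfold vadd in Hc. lra.
Qed.

(** * The Picard map *)

(** The ball appears so that the property follows from [smooth_coef], whose estimates live on
    bounded sets. As L is fixed before M, the constant is global. *)
Definition lipschitz_coef {r d} (L : R) (F : (Dr r -> Vec d) -> Vec d) : Prop :=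
  forall xi eta, Cr_cont xi -> Cr_cont eta ->
  forall M, bounded_by M xi -> bounded_by M eta ->
  forall D, 0 <= D -> bounded_by D (Cr_sub xi eta) ->
  forall i, Rabs (F xi i - F eta i) <= L * D.

(** A four-point estimate with L global and only [LM] local. It is applied to the segments of x and
    y at two times: D is the distance of the paths at the earlier time, E the time increment of
    their difference, P the time increment of each path. *)
Definition smooth_coef {r d} (delta L : R) (g : (Dr r -> Vec d) -> Vec d) : Prop :=
  forall M, 0 < M -> exists LM, 0 <= LM /\
    forall xi1 eta1 xi2 eta2, Cr_cont xi1 -> Cr_cont eta1 -> Cr_cont xi2 -> Cr_cont eta2 ->
    bounded_by M xi1 -> bounded_by M eta1 -> bounded_by M xi2 -> bounded_by M eta2 ->
    forall D E P, 0 <= D -> 0 <= E -> 0 <= P ->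
    bounded_by D (Cr_sub xi2 eta2) ->
    bounded_by E (Cr_sub (Cr_sub xi1 eta1) (Cr_sub xi2 eta2)) ->
    bounded_by P (Cr_sub xi1 xi2) -> bounded_by P (Cr_sub eta1 eta2) ->
    forall i, Rabs (g xi1 i - g eta1 i - (g xi2 i - g eta2 i)) <= L * E + LM * rpow P delta * D.

Lemma bounded_by_le {r d} (M M' : R) (xi : Dr r -> Vec d) :
  M <= M' -> bounded_by M xi -> bounded_by M' xi.
Proof. intros H HM u i. generalize (HM u i); lra. Qed.

(** Take xi2 = eta2 = eta1: then D = 0 and the term with [LM] disappears. *)
Lemma smooth_coef_lipschitz {r d} (delta L : R) (g : (Dr r -> Vec d) -> Vec d) :
  smooth_coef delta L g -> lipschitz_coef L g.
Proof.
  intros Hg xi eta Cxi Ceta M Bxi Beta D HD Hb i.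
  assert (HM : 0 < Rabs M + 1) by (generalize (Rabs_pos M); lra).
  assert (HMM : M <= Rabs M + 1) by (generalize (Rle_abs M); lra).
  destruct (Hg _ HM) as [LM [HLM H]].
  apply (bounded_by_le _ _ _ HMM) in Bxi. apply (bounded_by_le _ _ _ HMM) in Beta.
  assert (Hz : forall u j, Rabs (eta u j - eta u j) <= 0)
    by (intros; rewrite Rminus_diag Rabs_R0; lra).
  specialize (H xi eta eta eta Cxi Ceta Ceta Ceta Bxi Beta Beta Beta 0 D D
    (Rle_refl 0) HD HD Hz).
  replace (g xi i - g eta i) with (g xi i - g eta i - (g eta i - g eta i)) by ring.
  eapply Rle_trans; [apply H|lra].
  - intros u j. specialize (Hb u j). unfold Cr_sub, vsub in *.
    rewrite Rminus_diag Rminus_0_r. exact Hb.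
  - exact Hb.
  - intros u j. eapply Rle_trans; [apply Hz|exact HD].
Qed.

Definition path_holder {d} (beta H a b : R) (x : R -> Vec d) : Prop :=
  forall i, holder_on (fun t => x t i) beta H a b.

Lemma path_holder_abs {d} (beta H a b : R) (x : R -> Vec d) (s t : R) (i : 'I_d) :
  path_holder beta H a b x -> a <= s <= b -> a <= t <= b ->
  Rabs (x t i - x s i) <= H * rpow (Rabs (t - s)) beta.
Proof.
  intros Hx Hs Ht. destruct (Rle_dec s t) as [Hst|Hst].
  - rewrite (Rabs_right (t - s)); [|lra]. apply (Hx i); lra.
  - rewrite Rabs_minus_sym (Rabs_minus_sym t s) (Rabs_right (s - t)); [|lra]. apply (Hx i); lra.
Qed.

Lemma segment_cont {d} (r T beta H t : R) (x : R -> Vec d) :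
  0 < beta -> path_holder beta H (- r) T x -> 0 <= t <= T -> Cr_cont (segment r x t).
Proof.
  intros Hbeta Hx Ht. apply Cr_contP; intros u eps He.
  assert (HH : 0 < Rabs H + 1) by (generalize (Rabs_pos H); lra).
  destruct (rpow_small beta (eps / (Rabs H + 1))) as [h [Hh Hhe]];
    [exact Hbeta|apply Rdiv_lt_0_compat; lra|].
  exists h; split; [lra|]. intros v Hv i. unfold segment.
  assert (Hu := proj2_sig u). assert (Hv' := proj2_sig v). simpl in Hu, Hv'.
  eapply Rle_trans; [apply (path_holder_abs beta H (- r) T x _ _ i Hx); lra|].
  replace (t + proj1_sig v - (t + proj1_sig u)) with (proj1_sig v - proj1_sig u) by ring.
  set (z := Rabs (proj1_sig v - proj1_sig u)) in *.
  assert (Hz : rpow z beta <= eps / (Rabs H + 1)).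
  { eapply Rle_trans; [apply rpow_le; [left; exact Hv|lra]|exact Hhe]. }
  apply Rle_trans with ((Rabs H + 1) * (eps / (Rabs H + 1))).
  - apply Rle_trans with ((Rabs H + 1) * rpow z beta).
    + apply Rmult_le_compat_r; [apply rpow_ge0|generalize (Rle_abs H); lra].
    + apply Rmult_le_compat_l; lra.
  - apply Req_le; field; lra.
Qed.

(** The bound depends on the path only through x(0) and H, so it is uniform over paths that share
    the initial datum and H. *)
Lemma segment_bounded {d} (r T beta H t : R) (x : R -> Vec d) :
  0 < r -> 0 < beta -> 0 <= H -> path_holder beta H (- r) T x -> 0 <= t <= T ->
  bounded_by (vnorm (x 0) + H * rpow (r + T) beta) (segment r x t).
Proof.
  intros Hr Hbeta HH Hx Ht u i. unfold segment.
  assert (Hu := proj2_sig u). simpl in Hu.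
  assert (H0 := vnorm_ge_coord (x 0) i).
  assert (H1 := path_holder_abs beta H (- r) T x 0 (t + proj1_sig u) i Hx (ltac:(lra)) (ltac:(lra))).
  assert (H2 : rpow (Rabs (t + proj1_sig u - 0)) beta <= rpow (r + T) beta).
  { apply rpow_le; [apply Rabs_le; lra|lra]. }
  apply (Rmult_le_compat_l H) in H2; [|exact HH]. abs_lra.
Qed.

Lemma coef_holder {r d} (L : R) (F : (Dr r -> Vec d) -> Vec d) (T beta H : R) (x : R -> Vec d)
  (i : 'I_d) :
  0 < r -> 0 < beta -> 0 <= H -> lipschitz_coef L F -> path_holder beta H (- r) T x ->
  holder_on (fun s => F (segment r x s) i) beta (L * H) 0 T.
Proof.
  intros Hr Hbeta HH HF Hx s t Hs Hst Ht. rewrite Rmult_assoc.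
  apply HF with (M := vnorm (x 0) + H * rpow (r + T) beta).
  - apply (segment_cont r T beta H); try assumption; lra.
  - apply (segment_cont r T beta H); try assumption; lra.
  - apply segment_bounded; try assumption; lra.
  - apply segment_bounded; try assumption; lra.
  - apply Rmult_le_pos; [lra|apply rpow_ge0].
  - intros u j. unfold Cr_sub, vsub, segment.
    assert (Hu := proj2_sig u). simpl in Hu.
    replace (t - s) with ((t + proj1_sig u) - (s + proj1_sig u)) by ring.
    apply (Hx j); lra.
Qed.

Definition weighted_holder {d} (beta h N T : R) (z : R -> Vec d) : Prop :=
  forall s t, 0 <= s -> s <= t -> t <= T -> t - s <= h ->
  forall i, Rabs (z t i - z s i) <= N * exp (t / h) * rpow (t - s) beta.

Lemma exp_div_le (a b h : R) : 0 < h -> a <= b -> exp (a / h) <= exp (b / h).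
Proof.
  intros Hh [Hab| ->]; [|lra]. left; apply exp_increasing.
  apply Rmult_lt_compat_r; [apply Rinv_0_lt_compat; lra|lra].
Qed.

Lemma exp_div_ge1 (t h : R) : 0 < h -> 0 <= t -> 1 <= exp (t / h).
Proof.
  intros Hh Ht. rewrite -exp_0. replace 0 with (0 / h) at 1 by (field; lra).
  apply exp_div_le; lra.
Qed.

(* Going back one step of length [h] costs [N exp(t/h) h^beta] and divides the weight by [e >= 2], so the constant 2 reproduces itself. *)
Lemma weighted_holder_sup {d} (beta h N T : R) (z : R -> Vec d) :
  0 < beta -> 0 < h -> 0 <= N -> weighted_holder beta h N T z ->
  forall t i, 0 <= t <= T -> Rabs (z t i - z 0 i) <= 2 * N * exp (t / h) * rpow h beta.
Proof.
  intros Hbeta Hh HN Hz.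
  assert (Hn : forall n t i, 0 <= t <= T -> t <= INR n * h ->
    Rabs (z t i - z 0 i) <= 2 * N * exp (t / h) * rpow h beta).
  { assert (Hpos : forall t, 0 <= N * exp (t / h) * rpow h beta).
    { intros t. apply Rmult_le_pos; [|apply rpow_ge0].
      apply Rmult_le_pos; [lra|left; apply exp_pos]. }
    induction n as [|n IH]; intros t i Ht Htn.
    - simpl in Htn. replace t with 0 by lra. rewrite Rminus_diag Rabs_R0.
      generalize (Hpos 0); lra.
    - rewrite S_INR in Htn. destruct (Rle_dec t h) as [Hth|Hth].
      + assert (H1 := Hz 0 t (ltac:(lra)) (ltac:(lra)) (ltac:(lra)) (ltac:(lra)) i).
        assert (H2 : N * exp (t / h) * rpow (t - 0) beta <= N * exp (t / h) * rpow h beta).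
        { apply Rmult_le_compat_l; [apply Rmult_le_pos; [lra|left; apply exp_pos]|].
          apply rpow_le; lra. }
        generalize (Hpos t); lra.
      + assert (H1 := Hz (t - h) t (ltac:(lra)) (ltac:(lra)) (ltac:(lra)) (ltac:(lra)) i).
        assert (H2 := IH (t - h) i (ltac:(lra)) (ltac:(lra))).
        replace (t - (t - h)) with h in H1 by ring.
        assert (H3 : 2 * exp ((t - h) / h) <= exp (t / h)).
        { replace (t / h) with (1 + (t - h) / h) by (field; lra). rewrite exp_plus.
          apply Rmult_le_compat_r; [left; apply exp_pos|].
          generalize (exp_ineq1 1); lra. }
        apply (Rmult_le_compat_l (N * rpow h beta)) in H3;
          [|apply Rmult_le_pos; [lra|apply rpow_ge0]].
        abs_lra. }
  intros t i Ht. destruct (INR_unbounded (t / h)) as [n Hn'].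
  apply (Hn n t i Ht). apply (Rmult_lt_compat_r h) in Hn'; [|lra].
  replace (t / h * h) with t in Hn' by (field; lra). lra.
Qed.

Lemma path_holder_weighted {d} (beta h N T : R) (z : R -> Vec d) :
  0 < h -> 0 <= N -> path_holder beta N 0 T z -> weighted_holder beta h N T z.
Proof.
  intros Hh HN Hz s t Hs Hst Ht _ i.
  eapply Rle_trans; [apply (Hz i); lra|].
  apply Rmult_le_compat_r; [apply rpow_ge0|].
  generalize (Rmult_le_compat_l N _ _ HN (exp_div_ge1 t h Hh (ltac:(lra)))); lra.
Qed.

(** A relation, since the image is determined only on [-r, T]. It prescribes increments over every
    [s, t], the form in which the estimates use it; the value at 0 comes from the first clause. *)
Definition picard_step {d} (r T : R) (f g : (Dr r -> Vec d) -> Vec d) (w : R -> R)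
  (eta x x' : R -> Vec d) : Prop :=
  (forall u, - r <= u <= 0 -> x' u = eta u) /\
  forall s t, 0 <= s -> s <= t -> t <= T -> forall i, exists I1 I2,
    RS_scalar (fun u => f (segment r x u) i) (fun u => u) s t I1 /\
    RS_scalar (fun u => g (segment r x u) i) w s t I2 /\
    x' t i - x' s i = I1 + I2.

Lemma picard_step_exists {d} (r T : R) (f g : (Dr r -> Vec d) -> Vec d) (w : R -> R)
  (eta x : R -> Vec d) (Lf Lg nu Cw beta H : R) :
  0 < r -> 0 < T -> 0 < beta -> 0 <= nu -> 1 < beta + nu -> 0 <= Lf -> 0 <= Lg ->
  0 <= Cw -> 0 <= H ->
  lipschitz_coef Lf f -> lipschitz_coef Lg g -> holder_on w nu Cw 0 T ->
  path_holder beta H (- r) T x ->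
  exists x', picard_step r T f g w eta x x'.
Proof.
  intros Hr HT Hbeta Hnu Hbn HLf HLg HCw HH Hf Hg Hw Hx.
  assert (HJ1 : forall i, exists J, forall s t, 0 <= s -> s <= t -> t <= T ->
    RS_scalar (fun u => f (segment r x u) i) (fun u => u) s t (J t - J s)).
  { intros i. apply (young_exists _ _ beta 1 (Lf * H) 1); try lra.
    - apply Rmult_le_pos; lra.
    - apply coef_holder; assumption.
    - apply holder_on_id. }
  assert (HJ2 : forall i, exists J, forall s t, 0 <= s -> s <= t -> t <= T ->
    RS_scalar (fun u => g (segment r x u) i) w s t (J t - J s)).
  { intros i. apply (young_exists _ _ beta nu (Lg * H) Cw); try lra.
    - apply Rmult_le_pos; lra.
    - apply coef_holder; assumption.
    - assumption. }
  set (J1 := fun i => proj1_sig (constructive_indefinite_description _ (HJ1 i))).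
  set (J2 := fun i => proj1_sig (constructive_indefinite_description _ (HJ2 i))).
  assert (K1 := fun i => proj2_sig (constructive_indefinite_description _ (HJ1 i))).
  assert (K2 := fun i => proj2_sig (constructive_indefinite_description _ (HJ2 i))).
  cbv beta in K1, K2. fold J1 in K1. fold J2 in K2.
  (* The two branches agree at 0, where the increments of the primitives vanish. *)
  set (x' := fun t => if Rle_dec t 0 then eta t else
    (fun i => eta 0 i + (J1 i t - J1 i 0) + (J2 i t - J2 i 0)) : Vec d).
  assert (Hx' : forall t i, 0 <= t -> x' t i = eta 0 i + (J1 i t - J1 i 0) + (J2 i t - J2 i 0)).
  { intros t i Ht. unfold x'. destruct (Rle_dec t 0) as [H0|H0]; simpl; [|easy].
    replace t with 0 by lra. ring. }
  exists x'. split.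
  - intros u Hu. unfold x'. destruct (Rle_dec u 0); simpl; [easy|lra].
  - intros s t Hs Hst Ht i. exists (J1 i t - J1 i s), (J2 i t - J2 i s).
    split; [apply K1; assumption|split; [apply K2; assumption|]].
    rewrite !Hx'; [ring|lra|lra].
Qed.

(** Since t - s <= h <= 1, the powers 1, nu and alpha + nu of t - s are all at most h^(nu - beta) (t
    - s)^beta. Used with alpha = beta for the ball, alpha = beta*delta for the contraction, and with
    nu in place of beta and h = 1 for the final regularity. *)
Lemma increment_estimate (y1 y2 w : R -> R) (alpha beta nu B C Cw h s t I1 I2 : R) :
  0 <= alpha -> beta <= nu -> 0 <= nu -> nu <= 1 -> 1 < alpha + nu ->
  0 <= B -> 0 <= C -> 0 <= Cw -> s <= t -> t - s <= h -> h <= 1 ->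
  (forall u, s <= u <= t -> Rabs (y1 u) <= B) -> Rabs (y2 s) <= B ->
  holder_on y2 alpha C s t -> holder_on w nu Cw s t ->
  RS_scalar y1 (fun u => u) s t I1 -> RS_scalar y2 w s t I2 ->
  Rabs (I1 + I2) <= (B * (1 + Cw) + sewing_const (alpha + nu) * (C * Cw))
                    * (rpow h (nu - beta) * rpow (t - s) beta).
Proof.
  intros Ha Hbn Hn Hn1 Han HB HC HCw Hst Hh Hh1 Hy1 Hy2 Hhol Hw HI1 HI2.
  assert (K1 := riemann_estimate y1 s t I1 B Hst Hy1 HI1).
  assert (K2 := young_estimate y2 w alpha nu C Cw s t I2 HC HCw Ha Hn Han Hst Hhol Hw HI2).
  assert (K3 : Rabs (y2 s * (w t - w s)) <= B * Cw * rpow (t - s) nu).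
  { rewrite Rabs_mult Rmult_assoc. apply Rmult_le_compat; try apply Rabs_pos; [exact Hy2|].
    apply Hw; lra. }
  set (q := rpow h (nu - beta) * rpow (t - s) beta).
  assert (P0 : rpow (t - s) nu <= q) by (apply rpow_weaken; lra).
  assert (P1 : t - s <= q).
  { rewrite -{1}(rpow_1r (t - s)); [|lra].
    eapply Rle_trans; [apply (rpow_le1 (t - s) 1 nu); lra|exact P0]. }
  assert (P2 : rpow (t - s) (alpha + nu) <= q).
  { eapply Rle_trans; [apply (rpow_le1 (t - s) (alpha + nu) nu); lra|exact P0]. }
  assert (HBC : 0 <= B * Cw) by (apply Rmult_le_pos; lra).
  assert (HS : 0 <= sewing_const (alpha + nu) * (C * Cw)).
  { apply Rmult_le_pos; [apply sewing_const_ge0; lra|apply Rmult_le_pos; lra]. }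
  apply (Rmult_le_compat_l _ _ _ HBC) in P0.
  apply (Rmult_le_compat_l _ _ _ HB) in P1.
  apply (Rmult_le_compat_l _ _ _ HS) in P2.
  abs_lra.
Qed.

(** A shifted interval [u + a, v + a] may straddle 0. It is then cut there; both pieces have length
    at most v - u, so the constants of past and future add up. *)
Lemma prehistory_increment {d} (r T beta H0 h N u v a e : R) (eta x : R -> Vec d) (i : 'I_d) :
  0 < beta -> 0 < h -> 0 <= N -> 0 <= H0 ->
  (forall s, - r <= s <= 0 -> x s = eta s) -> path_holder beta H0 (- r) 0 eta ->
  weighted_holder beta h N T x -> - r <= a <= 0 ->
  0 <= u -> u <= v -> v <= T -> v - u <= h -> exp (v / h) <= e ->
  Rabs (x (v + a) i - x (u + a) i) <= (H0 + N * e) * rpow (v - u) beta.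
Proof.
  intros Hbeta Hh HN HH0 Hx Heta Hw Ha Hu Huv Hv Hvu He.
  assert (Hr0 := rpow_ge0 (v - u) beta).
  assert (He0 : 0 < exp (v / h)) by apply exp_pos.
  assert (HNe : 0 <= N * e) by (apply Rmult_le_pos; lra).
  assert (W : forall s, 0 <= s -> s <= v + a -> v + a - s <= v - u ->
    Rabs (x (v + a) i - x s i) <= N * e * rpow (v - u) beta).
  { intros s Hs Hsv Hsu. eapply Rle_trans; [apply Hw; lra|].
    apply Rmult_le_compat; [|apply rpow_ge0| |apply rpow_le; lra].
    - apply Rmult_le_pos; [lra|left; apply exp_pos].
    - apply Rmult_le_compat_l; [lra|].
      eapply Rle_trans; [apply (exp_div_le (v + a) v); lra|exact He]. }
  assert (E : forall s t, - r <= s -> s <= t -> t <= 0 -> t - s <= v - u ->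
    Rabs (x t i - x s i) <= H0 * rpow (v - u) beta).
  { intros s t Hs Hst Ht Hts. rewrite (Hx t) ?(Hx s); [|lra|lra].
    eapply Rle_trans; [apply (Heta i); lra|].
    apply Rmult_le_compat_l; [lra|apply rpow_le; lra]. }
  assert (P1 := Rmult_le_pos _ _ HNe Hr0). assert (P2 := Rmult_le_pos _ _ HH0 Hr0).
  rewrite Rmult_plus_distr_r.
  destruct (Rle_dec 0 (u + a)) as [H1|H1]; [|destruct (Rle_dec (v + a) 0) as [H2|H2]].
  - generalize (W (u + a) H1 (ltac:(lra)) (ltac:(lra))); lra.
  - generalize (E (u + a) (v + a) (ltac:(lra)) (ltac:(lra)) H2 (ltac:(lra))); lra.
  - assert (K1 := W 0 (ltac:(lra)) (ltac:(lra)) (ltac:(lra))).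
    assert (K2 := E (u + a) 0 (ltac:(lra)) (ltac:(lra)) (ltac:(lra)) (ltac:(lra))).
    abs_lra.
Qed.

(** A radius R0 is mapped into (C1 + C2 R0) h^(nu - beta), so R0 = C1 is preserved once (C2 + 1)
    h^(nu - beta) <= 1. Both h and R0 are chosen before H, which serves to make the segments
    continuous and bounded. *)
Lemma invariant_ball {d} (r T : R) (f g : (Dr r -> Vec d) -> Vec d) (w : R -> R)
  (eta : R -> Vec d) (L nu Cw beta H0 : R) :
  0 < r -> 0 < T -> 0 < beta -> beta < nu -> nu <= 1 -> 1 < beta + nu -> 0 <= L ->
  0 <= Cw -> 0 <= H0 ->
  lipschitz_coef L f -> lipschitz_coef L g -> holder_on w nu Cw 0 T ->
  path_holder beta H0 (- r) 0 eta ->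
  exists h R0, 0 < h <= 1 /\ 0 <= R0 /\ forall x x' H, 0 <= H ->
    (forall s, - r <= s <= 0 -> x s = eta s) -> path_holder beta H (- r) T x ->
    weighted_holder beta h R0 T x -> picard_step r T f g w eta x x' ->
    weighted_holder beta h R0 T x'.
Proof.
  intros Hr HT Hbeta Hbn Hn1 Hbn1 HL HCw HH0 Hf Hg Hw Heta.
  set (xi0 := segment r eta 0).
  (* Size of the coefficients at the initial segment, plus the effect of the oscillation of
     [eta]. *)
  set (A := vnorm (f xi0) + vnorm (g xi0) + L * (H0 * rpow r beta)).
  set (S0 := sewing_const (beta + nu)).
  assert (HS0 : 0 <= S0) by (apply sewing_const_ge0; lra).
  assert (HHr : 0 <= H0 * rpow r beta) by (apply Rmult_le_pos; [lra|apply rpow_ge0]).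
  assert (HA : 0 <= A).
  { generalize (vnorm_ge0 (f xi0)) (vnorm_ge0 (g xi0)) (Rmult_le_pos _ _ HL HHr). unfold A; lra. }
  set (C1 := A * (1 + Cw) + S0 * (L * H0 * Cw)).
  set (C2 := 2 * L * (1 + Cw) + S0 * (L * Cw)).
  assert (HLC : 0 <= L * Cw) by (apply Rmult_le_pos; lra).
  assert (HC1 : 0 <= C1).
  { apply Rplus_le_le_0_compat; apply Rmult_le_pos; try lra.
    apply Rmult_le_pos; [apply Rmult_le_pos; lra|lra]. }
  assert (HC2 : 0 <= C2).
  { apply Rplus_le_le_0_compat; apply Rmult_le_pos; lra. }
  destruct (rpow_small (nu - beta) (/ (C2 + 1))) as [h [Hh Hhs]];
    [lra|apply Rinv_0_lt_compat; lra|].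
  exists h, C1. split; [exact Hh|split; [exact HC1|]].
  intros x x' H HH Hx Hxh Hxw [_ Hstep] s t Hs Hst Ht Hts i.
  destruct (Hstep s t Hs Hst Ht i) as [I1 [I2 [HI1 [HI2 Heq]]]]. rewrite Heq.
  set (e := exp (t / h)).
  assert (He : 1 <= e) by (apply exp_div_ge1; lra).
  assert (Hhb : rpow h beta <= 1) by (rewrite -(rpow_1l beta); apply rpow_le; lra).
  assert (Hhb0 := rpow_ge0 h beta).
  assert (Hxc : path_holder beta H0 (- r) 0 x).
  { intros j a b Ha Hab Hb. rewrite (Hx a) ?(Hx b); [apply (Heta j)|lra|lra]; lra. }
  assert (Hseg0 : segment r x 0 = xi0).
  { apply functional_extensionality; intros u. unfold xi0, segment.
    apply Hx. generalize (proj2_sig u); simpl; lra. }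
  assert (Cseg : forall u, 0 <= u <= T -> Cr_cont (segment r x u))
    by (intros; apply (segment_cont r T beta H); assumption).
  assert (Bseg : forall u, 0 <= u <= T ->
    bounded_by (vnorm (x 0) + H * rpow (r + T) beta) (segment r x u))
    by (intros; apply segment_bounded; assumption).
  (* Bounds x_u - x_0: the part after time 0 by the weighted sup estimate, the part before by the
     oscillation of [eta]. *)
  set (D := 2 * C1 * e + H0 * rpow r beta).
  assert (HC1e : 0 <= C1 * e) by (apply Rmult_le_pos; lra).
  assert (HD : 0 <= D) by (unfold D; lra).
  assert (HF : forall F : (Dr r -> Vec d) -> Vec d, lipschitz_coef L F ->
    forall u, s <= u <= t -> Rabs (F (segment r x u) i) <= vnorm (F xi0) + L * D).
  { intros F HF u Hu.
    assert (H1 := vnorm_ge_coord (F xi0) i).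
    assert (H2 : Rabs (F (segment r x u) i - F xi0 i) <= L * D).
    { rewrite -Hseg0. apply (HF _ _ (Cseg u (ltac:(lra))) (Cseg 0 (ltac:(lra)))
        _ (Bseg u (ltac:(lra))) (Bseg 0 (ltac:(lra))) D HD).
      intros v j. unfold Cr_sub, vsub, segment. assert (Hv := proj2_sig v). simpl in Hv.
      set (a := proj1_sig v) in *. rewrite Rplus_0_l.
      assert (Hback : forall b, - r <= b <= 0 -> Rabs (x b j - x a j) <= H0 * rpow r beta).
      { intros b Hb. eapply Rle_trans; [apply (path_holder_abs beta H0 (- r) 0 x a b j Hxc); lra|].
        apply Rmult_le_compat_l; [lra|]. apply rpow_le; [apply Rabs_le; lra|lra]. }
      destruct (Rle_dec (u + a) 0) as [Hua|Hua].
      - generalize (Hback (u + a) (ltac:(lra))). unfold D; lra.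
      - assert (K1 := Hback 0 (ltac:(lra))).
        assert (K2 := weighted_holder_sup beta h C1 T x Hbeta (ltac:(lra)) HC1 Hxw (u + a) j
          (ltac:(lra))).
        assert (K3 : 2 * C1 * exp ((u + a) / h) * rpow h beta <= 2 * C1 * e).
        { rewrite -(Rmult_1_r (2 * C1 * e)). apply Rmult_le_compat; try lra.
          - apply Rmult_le_pos; [lra|left; apply exp_pos].
          - apply Rmult_le_compat_l; [lra|]. apply exp_div_le; lra. }
        unfold D. abs_lra. }
    abs_lra. }
  set (B := (A + 2 * L * C1) * e).
  assert (HLC1 : 0 <= L * C1) by (apply Rmult_le_pos; lra).
  assert (HB : 0 <= B) by (apply Rmult_le_pos; lra).
  assert (HBB : vnorm (f xi0) + L * D <= B /\ vnorm (g xi0) + L * D <= B).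
  { assert (HLr : 0 <= L * (H0 * rpow r beta)) by (apply Rmult_le_pos; lra).
    assert (HAe : A * 1 <= A * e) by (apply Rmult_le_compat_l; lra).
    generalize (vnorm_ge0 (f xi0)) (vnorm_ge0 (g xi0)).
    unfold B, D. unfold A in HAe at 1. split; lra. }
  assert (Hghol : holder_on (fun u => g (segment r x u) i) beta (L * (H0 + C1 * e)) s t).
  { intros u v Hu Huv Hv. rewrite Rmult_assoc.
    apply (Hg _ _ (Cseg v (ltac:(lra))) (Cseg u (ltac:(lra)))
        _ (Bseg v (ltac:(lra))) (Bseg u (ltac:(lra)))).
    - apply Rmult_le_pos; [lra|apply rpow_ge0].
    - intros b j. unfold Cr_sub, vsub, segment. assert (Hb := proj2_sig b). simpl in Hb.
      apply (prehistory_increment r T beta H0 h C1 u v _ e eta); try assumption; try lra.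
      apply exp_div_le; lra. }
  assert (Hinc := increment_estimate _ _ w beta beta nu B (L * (H0 + C1 * e)) Cw h s t I1 I2
    (ltac:(lra)) (ltac:(lra)) (ltac:(lra)) Hn1 Hbn1 HB
    (ltac:(apply Rmult_le_pos; lra)) HCw Hst Hts (proj2 Hh)
    (fun u Hu => Rle_trans _ _ _ (HF f Hf u Hu) (proj1 HBB))
    (Rle_trans _ _ _ (HF g Hg s (conj (Rle_refl s) Hst)) (proj2 HBB))
    Hghol (holder_on_sub w nu Cw 0 T s t Hs Ht Hw) HI1 HI2).
  eapply Rle_trans; [exact Hinc|]. fold S0.
  (* Terms without the weight are absorbed through 1 <= e. *)
  assert (Hbr : B * (1 + Cw) + S0 * (L * (H0 + C1 * e) * Cw) <= (C1 + C2 * C1) * e).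
  { change ((C1 + C2 * C1) * e) with ((A * (1 + Cw) + S0 * (L * H0 * Cw) + C2 * C1) * e).
    replace ((A * (1 + Cw) + S0 * (L * H0 * Cw) + C2 * C1) * e)
      with (B * (1 + Cw) + S0 * (L * (H0 * e + C1 * e) * Cw)) by (unfold B, C2; ring).
    apply Rplus_le_compat_l. apply Rmult_le_compat_l; [exact HS0|].
    apply Rmult_le_compat_r; [lra|]. apply Rmult_le_compat_l; [lra|].
    generalize (Rmult_le_compat_l H0 _ _ HH0 He); lra. }
  assert (Hsmall : (C1 + C2 * C1) * rpow h (nu - beta) <= C1).
  { apply Rle_trans with ((C1 + C2 * C1) * / (C2 + 1)).
    - apply Rmult_le_compat_l; [|exact Hhs].
      generalize (Rmult_le_pos _ _ HC2 HC1); lra.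
    - apply Req_le; field; lra. }
  assert (Hts0 := rpow_ge0 (t - s) beta). assert (Hh0 := rpow_ge0 h (nu - beta)).
  apply Rle_trans with ((C1 + C2 * C1) * e * (rpow h (nu - beta) * rpow (t - s) beta)).
  - apply Rmult_le_compat_r; [apply Rmult_le_pos; assumption|exact Hbr].
  - replace ((C1 + C2 * C1) * e * (rpow h (nu - beta) * rpow (t - s) beta))
      with (((C1 + C2 * C1) * rpow h (nu - beta)) * (e * rpow (t - s) beta)) by ring.
    rewrite (Rmult_assoc C1). apply Rmult_le_compat_r; [apply Rmult_le_pos; lra|exact Hsmall].
Qed.

Definition path_sub {d} (x y : R -> Vec d) : R -> Vec d := fun t => vsub (x t) (y t).

(** The scale h depends on the paths only through their common Hölder constant H and initial datum;
    N is arbitrary, so the estimate can be iterated. *)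
Lemma contraction {d} (r T : R) (f g : (Dr r -> Vec d) -> Vec d) (w : R -> R)
  (eta : R -> Vec d) (L nu delta Cw beta H : R) :
  0 < r -> 0 < T -> 0 < beta -> beta < nu -> nu <= 1 -> 0 <= delta <= 1 ->
  1 < beta * delta + nu -> 0 <= L -> 0 <= Cw -> 0 <= H ->
  lipschitz_coef L f -> smooth_coef delta L g -> holder_on w nu Cw 0 T ->
  exists h, 0 < h <= 1 /\ forall x y x' y' N, 0 <= N ->
    (forall s, - r <= s <= 0 -> x s = eta s) -> (forall s, - r <= s <= 0 -> y s = eta s) ->
    path_holder beta H (- r) T x -> path_holder beta H (- r) T y ->
    picard_step r T f g w eta x x' -> picard_step r T f g w eta y y' ->
    weighted_holder beta h N T (path_sub x y) ->
    weighted_holder beta h (N / 2) T (path_sub x' y').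
Proof.
  intros Hr HT Hbeta Hbn Hn1 Hdelta Hbd HL HCw HH Hf Hg Hw.
  assert (Hbdl : 0 <= beta * delta) by (apply Rmult_le_pos; lra).
  assert (Hbdb : beta * delta <= beta)
    by (rewrite -{2}(Rmult_1_r beta); apply Rmult_le_compat_l; lra).
  set (M := vnorm (eta 0) + H * rpow (r + T) beta + 1).
  assert (HHr : 0 <= H * rpow (r + T) beta) by (apply Rmult_le_pos; [lra|apply rpow_ge0]).
  destruct (Hg M) as [LM [HLM HgM]]; [generalize (vnorm_ge0 (eta 0)); unfold M; lra|].
  set (S0 := sewing_const (beta * delta + nu)).
  assert (HS0 : 0 <= S0) by (apply sewing_const_ge0; lra).
  (* L comes from the E-term; 2 LM H^delta comes from D = 2 N e and P = H (v - u)^beta. *)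
  set (Cg := L + 2 * (LM * rpow H delta)).
  assert (HLMH : 0 <= LM * rpow H delta) by (apply Rmult_le_pos; [lra|apply rpow_ge0]).
  assert (HCg : 0 <= Cg) by (unfold Cg; lra).
  set (C := 2 * L * (1 + Cw) + S0 * (Cg * Cw)).
  assert (HC : 0 <= C).
  { apply Rplus_le_le_0_compat; apply Rmult_le_pos; try lra. apply Rmult_le_pos; lra. }
  (* Chosen so that C h^(nu - beta) <= 1/2. *)
  destruct (rpow_small (nu - beta) (/ (2 * (C + 1)))) as [h [Hh Hhs]];
    [lra|apply Rinv_0_lt_compat; lra|].
  exists h; split; [exact Hh|].
  intros x y x' y' N HN Hx Hy Hxh Hyh [_ Hsx] [_ Hsy] Hz s t Hs Hst Ht Hts i.
  destruct (Hsx s t Hs Hst Ht i) as [I1 [I2 [HI1 [HI2 Heq]]]].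
  destruct (Hsy s t Hs Hst Ht i) as [J1 [J2 [HJ1 [HJ2 Heq']]]].
  replace (path_sub x' y' t i - path_sub x' y' s i) with ((I1 - J1) + (I2 - J2))
    by (unfold path_sub, vsub; lra).
  set (e := exp (t / h)).
  assert (He : 1 <= e) by (apply exp_div_ge1; lra).
  assert (Hhb : rpow h beta <= 1) by (rewrite -(rpow_1l beta); apply rpow_le; lra).
  assert (Hhb0 := rpow_ge0 h beta).
  assert (HNe : 0 <= N * e) by (apply Rmult_le_pos; lra).
  set (z := path_sub x y) in *.
  assert (Hz0 : forall u, - r <= u <= 0 -> forall j, z u j = 0).
  { intros u Hu j. unfold z, path_sub, vsub. rewrite Hx ?Hy; [ring|exact Hu|exact Hu]. }
  assert (Hzh : path_holder beta 0 (- r) 0 z).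
  { intros j a b Ha Hab Hb. rewrite !Hz0; [|lra|lra]. rewrite Rminus_diag Rabs_R0; lra. }
  assert (Cx : forall u, s <= u <= t -> Cr_cont (segment r x u))
    by (intros; apply (segment_cont r T beta H); try assumption; lra).
  assert (Cy : forall u, s <= u <= t -> Cr_cont (segment r y u))
    by (intros; apply (segment_cont r T beta H); try assumption; lra).
  assert (Bx : forall u, s <= u <= t -> bounded_by M (segment r x u)).
  { intros u Hu. apply (bounded_by_le (vnorm (x 0) + H * rpow (r + T) beta)).
    - rewrite Hx; [unfold M; lra|lra].
    - apply segment_bounded; try assumption; lra. }
  assert (By : forall u, s <= u <= t -> bounded_by M (segment r y u)).
  { intros u Hu. apply (bounded_by_le (vnorm (y 0) + H * rpow (r + T) beta)).
    - rewrite Hy; [unfold M; lra|lra].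
    - apply segment_bounded; try assumption; lra. }
  assert (Bz : forall u, s <= u <= t ->
    bounded_by (2 * (N * e)) (Cr_sub (segment r x u) (segment r y u))).
  { intros u Hu v j. assert (Hv := proj2_sig v). simpl in Hv.
    change (Rabs (z (u + proj1_sig v) j) <= 2 * (N * e)).
    set (a := proj1_sig v) in *.
    destruct (Rle_dec (u + a) 0) as [Hua|Hua]; [rewrite Hz0; [rewrite Rabs_R0|]; lra|].
    assert (K := weighted_holder_sup beta h N T z Hbeta (ltac:(lra)) HN Hz (u + a) j (ltac:(lra))).
    rewrite (Hz0 0) ?Rminus_0_r in K; [|lra].
    eapply Rle_trans; [exact K|]. rewrite -(Rmult_1_r (2 * (N * e))).
    apply Rmult_le_compat; try lra.
    - apply Rmult_le_pos; [lra|left; apply exp_pos].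
    - rewrite -Rmult_assoc. apply Rmult_le_compat_l; [lra|]. apply exp_div_le; lra. }
  assert (Hsup : forall F : (Dr r -> Vec d) -> Vec d, lipschitz_coef L F -> forall u, s <= u <= t ->
    Rabs (F (segment r x u) i - F (segment r y u) i) <= L * (2 * (N * e))).
  { intros F HF u Hu.
    apply (HF _ _ (Cx u Hu) (Cy u Hu) _ (Bx u Hu) (By u Hu)); [lra|apply Bz; exact Hu]. }
  assert (Hghol : holder_on (fun u => g (segment r x u) i - g (segment r y u) i)
    (beta * delta) (Cg * (N * e)) s t).
  { intros u v Hu Huv Hv.
    assert (Hru : s <= u <= t) by lra. assert (Hrv : s <= v <= t) by lra.
    assert (Hvu := rpow_ge0 (v - u) beta).
    assert (Hpx : forall q : R -> Vec d, path_holder beta H (- r) T q ->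
      bounded_by (H * rpow (v - u) beta) (Cr_sub (segment r q v) (segment r q u))).
    { intros q Hq b j. assert (Hb := proj2_sig b). simpl in Hb.
      unfold Cr_sub, vsub, segment.
      replace (v - u) with ((v + proj1_sig b) - (u + proj1_sig b)) by ring.
      apply (Hq j); lra. }
    eapply Rle_trans.
    - apply (HgM _ _ _ _ (Cx v Hrv) (Cy v Hrv) (Cx u Hru) (Cy u Hru)
        (Bx v Hrv) (By v Hrv) (Bx u Hru) (By u Hru) (2 * (N * e))
        (N * e * rpow (v - u) beta) (H * rpow (v - u) beta)).
      + lra.
      + apply Rmult_le_pos; lra.
      + apply Rmult_le_pos; lra.
      + apply Bz; exact Hru.
      + intros b j. assert (Hb := proj2_sig b). simpl in Hb.
        change (Rabs (z (v + proj1_sig b) j - z (u + proj1_sig b) j) <= N * e * rpow (v - u) beta).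
        (* The difference z vanishes on [-r, 0], so it serves as its own prehistory with Hölder
           constant 0. *)
        rewrite -(Rplus_0_l (N * e)).
        apply (prehistory_increment r T beta 0 h N u v _ e z); try assumption; try lra; try easy.
        apply exp_div_le; lra.
      + apply Hpx; exact Hxh.
      + apply Hpx; exact Hyh.
    - rewrite rpow_mul; [|lra|lra]. rewrite rpow_rpow; [|lra].
      (* The E-term has the better exponent beta; it is lowered to beta*delta, which v - u <= 1
         permits. *)
      assert (Hp : rpow (v - u) beta <= rpow (v - u) (beta * delta)) by (apply rpow_le1; lra).
      apply (Rmult_le_compat_l (L * (N * e))) in Hp; [|apply Rmult_le_pos; lra].
      unfold Cg. lra. }
  assert (Hinc := increment_estimate _ _ w (beta * delta) beta nu (L * (2 * (N * e))) (Cg * (N * e))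
    Cw h s t (I1 - J1) (I2 - J2) Hbdl (ltac:(lra)) (ltac:(lra)) Hn1 Hbd
    (ltac:(apply Rmult_le_pos; lra)) (ltac:(apply Rmult_le_pos; lra)) HCw Hst Hts (proj2 Hh)
    (Hsup f Hf) (Hsup g (smooth_coef_lipschitz delta L g Hg) s (conj (Rle_refl s) Hst))
    Hghol (holder_on_sub w nu Cw 0 T s t Hs Ht Hw)
    (RS_scalar_sub _ _ _ _ _ _ _ HI1 HJ1) (RS_scalar_sub _ _ _ _ _ _ _ HI2 HJ2)).
  eapply Rle_trans; [exact Hinc|]. fold S0.
  replace ((L * (2 * (N * e)) * (1 + Cw) + S0 * (Cg * (N * e) * Cw)) *
    (rpow h (nu - beta) * rpow (t - s) beta))
    with (C * rpow h (nu - beta) * (N * e * rpow (t - s) beta)) by (unfold C; ring).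
  replace (N / 2 * e * rpow (t - s) beta) with (/ 2 * (N * e * rpow (t - s) beta)) by field.
  apply Rmult_le_compat_r; [apply Rmult_le_pos; [lra|apply rpow_ge0]|].
  apply Rle_trans with ((C + 1) * / (2 * (C + 1))).
  - apply Rmult_le_compat; [lra|apply rpow_ge0|lra|exact Hhs].
  - apply Req_le; field; lra.
Qed.

(** * Fixed points *)

(** Gaps longer than h are covered by the sup bound at both ends, 2 C h^beta each, and h^beta <= (t
    - s)^beta; this gives the factor 4. *)
Lemma weighted_holder_global {d} (r T beta h N H0 : R) (eta x : R -> Vec d) :
  0 < r -> 0 < T -> 0 < beta -> 0 < h -> 0 <= N -> 0 <= H0 ->
  path_holder beta H0 (- r) 0 eta -> (forall s, - r <= s <= 0 -> x s = eta s) ->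
  weighted_holder beta h N T x ->
  path_holder beta (H0 + 4 * (N * exp (T / h))) (- r) T x.
Proof.
  intros Hr HT Hbeta Hh HN HH0 Heta Hx Hw i.
  set (C := N * exp (T / h)).
  assert (HC : 0 <= C) by (apply Rmult_le_pos; [lra|left; apply exp_pos]).
  assert (Hexp : forall t, t <= T -> N * exp (t / h) <= C).
  { intros t Ht. apply Rmult_le_compat_l; [lra|]. apply exp_div_le; lra. }
  assert (Hfut : forall s t, 0 <= s -> s <= t -> t <= T ->
    Rabs (x t i - x s i) <= 4 * C * rpow (t - s) beta).
  { intros s t Hs Hst Ht. assert (Hp := rpow_ge0 (t - s) beta).
    destruct (Rle_dec (t - s) h) as [H1|H1].
    - eapply Rle_trans; [apply Hw; lra|]. apply Rmult_le_compat_r; [exact Hp|].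
      generalize (Hexp t Ht); lra.
    - assert (K1 := weighted_holder_sup beta h N T x Hbeta Hh HN Hw t i (ltac:(lra))).
      assert (K2 := weighted_holder_sup beta h N T x Hbeta Hh HN Hw s i (ltac:(lra))).
      assert (Hb : forall u, u <= T ->
        2 * N * exp (u / h) * rpow h beta <= 2 * C * rpow (t - s) beta).
      { intros u Hu. generalize (Hexp u Hu); intros Hu'.
        apply Rmult_le_compat; [|apply rpow_ge0|lra|apply rpow_le; lra].
        apply Rmult_le_pos; [lra|left; apply exp_pos]. }
      generalize (Hb t Ht) (Hb s (ltac:(lra))); intros B1 B2. abs_lra. }
  assert (Hpast : forall s t, - r <= s -> s <= t -> t <= 0 ->
    Rabs (x t i - x s i) <= H0 * rpow (t - s) beta).
  { intros s t Hs Hst Ht. rewrite (Hx t) ?(Hx s); [|lra|lra]. apply (Heta i); lra. }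
  intros s t Hs Hst Ht. assert (Hp := rpow_ge0 (t - s) beta).
  assert (P1 := Rmult_le_pos _ _ HC Hp). assert (P2 := Rmult_le_pos _ _ HH0 Hp).
  rewrite Rmult_plus_distr_r.
  destruct (Rle_dec 0 s) as [H1|H1]; [|destruct (Rle_dec t 0) as [H2|H2]].
  - generalize (Hfut s t H1 Hst Ht); lra.
  - generalize (Hpast s t Hs Hst H2); lra.
  - assert (K1 := Hfut 0 t (ltac:(lra)) (ltac:(lra)) Ht).
    assert (K2 := Hpast s 0 Hs (ltac:(lra)) (ltac:(lra))).
    assert (Q1 : rpow (t - 0) beta <= rpow (t - s) beta) by (apply rpow_le; lra).
    assert (Q2 : rpow (0 - s) beta <= rpow (t - s) beta) by (apply rpow_le; lra).
    apply (Rmult_le_compat_l (4 * C)) in Q1; [|lra].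
    apply (Rmult_le_compat_l _ _ _ HH0) in Q2. abs_lra.
Qed.

(** Dependent choice: the invariant P is carried along because the next step exists only inside
    P. *)
Lemma iterate_choice (A : Type) (P : A -> Prop) (Q : A -> A -> Prop) (a : A) :
  P a -> (forall b, P b -> exists c, P c /\ Q b c) ->
  exists u : nat -> A, u O = a /\ forall n, P (u n) /\ Q (u n) (u (S n)).
Proof.
  intros Ha Hstep.
  set (next := fun b : {b | P b} =>
    let c := constructive_indefinite_description _ (Hstep _ (proj2_sig b)) in
    exist P (proj1_sig c) (proj1 (proj2_sig c))).
  set (u := fix u n := match n with O => exist P a Ha | S m => next (u m) end).
  exists (fun n => proj1_sig (u n)). split; [easy|]. intros n.
  split; [apply (proj2_sig (u n))|].
  exact (proj2 (proj2_sig (constructive_indefinite_description _ (Hstep _ (proj2_sig (u n)))))).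
Qed.

Lemma zero_of_geometric (a c q : R) :
  0 <= q < 1 -> 0 <= c -> (forall n, Rabs a <= c * q ^ n) -> a = 0.
Proof.
  intros Hq Hc H. assert (H0 : Rabs a <= 0).
  { apply (le_of_all_eps _ _ c); intros eps He. destruct (pow_small q eps Hq He) as [n Hn].
    apply (Rmult_le_compat_l c) in Hn; [|lra]. generalize (H n); lra. }
  abs_lra.
Qed.

Lemma fixed_point_exists {d} (r T : R) (f g : (Dr r -> Vec d) -> Vec d) (w : R -> R)
  (eta : R -> Vec d) (L nu delta Cw beta H0 : R) :
  0 < r -> 0 < T -> 0 < beta -> beta < nu -> nu <= 1 -> 0 <= delta <= 1 ->
  1 < beta * delta + nu -> 0 <= L -> 0 <= Cw -> 0 <= H0 ->
  lipschitz_coef L f -> smooth_coef delta L g -> holder_on w nu Cw 0 T ->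
  path_holder beta H0 (- r) 0 eta ->
  exists x H, 0 <= H /\ path_holder beta H (- r) T x /\ picard_step r T f g w eta x x.
Proof.
  intros Hr HT Hbeta Hbn Hn1 Hdelta Hbd HL HCw HH0 Hf Hg Hw Heta.
  assert (Hbn1 : 1 < beta + nu).
  { assert (beta * delta <= beta * 1) by (apply Rmult_le_compat_l; lra). lra. }
  assert (HgL := smooth_coef_lipschitz delta L g Hg).
  destruct (invariant_ball r T f g w eta L nu Cw beta H0) as [h1 [R0 [Hh1 [HR0 Hinv]]]];
    try assumption.
  set (H := H0 + 4 * (R0 * exp (T / h1))).
  assert (HH : 0 <= H).
  { generalize (Rmult_le_pos _ _ HR0 (Rlt_le _ _ (exp_pos (T / h1)))); unfold H; lra. }
  destruct (contraction r T f g w eta L nu delta Cw beta H) as [h [Hh Hcontr]]; try assumption.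
  set (P := fun x : R -> Vec d =>
    (forall s, - r <= s <= 0 -> x s = eta s) /\ weighted_holder beta h1 R0 T x).
  assert (HPH : forall x, P x -> path_holder beta H (- r) T x).
  { intros x [Hx Hxw]. apply (weighted_holder_global r T beta h1 R0 H0 eta); try assumption; lra. }
  assert (Hstep : forall x H', 0 <= H' -> path_holder beta H' (- r) T x ->
    exists x', picard_step r T f g w eta x x').
  { intros x H' HH' Hx. apply (picard_step_exists r T f g w eta x L L nu Cw beta H');
      try assumption; lra. }
  (* The iteration starts from [eta] continued by the constant eta(0), whose increments on [0, T]
     vanish. *)
  destruct (iterate_choice (R -> Vec d) P (picard_step r T f g w eta)
    (fun t => eta (Rmin t 0))) as [X [_ HX]].
  { split.
    - intros s Hs. rewrite Rmin_left; [easy|lra].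
    - intros s t Hs Hst Ht _ i. rewrite !Rmin_right; [|lra|lra]. rewrite Rminus_diag Rabs_R0.
      apply Rmult_le_pos; [|apply rpow_ge0]. apply Rmult_le_pos; [lra|left; apply exp_pos]. }
  { intros x Hx. destruct (Hstep x H HH (HPH x Hx)) as [x' Hx'].
    exists x'; split; [|exact Hx']. split; [exact (proj1 Hx')|].
    apply (Hinv x x' H HH (proj1 Hx) (HPH x Hx) (proj2 Hx) Hx'). }
  assert (HP : forall n, P (X n)) by (intros n; apply (HX n)).
  assert (HS : forall n, picard_step r T f g w eta (X n) (X (S n))) by (intros n; apply (HX n)).
  (* Two paths with Hölder constant H differ by a path with constant 2 H. *)
  set (N := 2 * H). set (q := / 2).
  assert (Hq : 0 <= q < 1) by (unfold q; lra).
  assert (HN : 0 <= N) by (unfold N; lra).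
  assert (HNq : forall n, 0 <= N * q ^ n).
  { intros n; apply Rmult_le_pos; [lra|apply pow_le; lra]. }
  assert (Hdiff : forall n, weighted_holder beta h (N * q ^ n) T (path_sub (X (S n)) (X n))).
  { induction n as [|n IH].
    - simpl; rewrite Rmult_1_r. apply path_holder_weighted; [lra|lra|].
      intros i s t Hs Hst Ht. unfold path_sub, vsub.
      assert (K1 := HPH _ (HP 1%nat) i s t (ltac:(lra)) Hst Ht).
      assert (K2 := HPH _ (HP O) i s t (ltac:(lra)) Hst Ht).
      unfold N. cbv beta in K1, K2. abs_lra.
    - replace (N * q ^ S n) with (N * q ^ n / 2) by (unfold q; simpl; field).
      apply (Hcontr (X (S n)) (X n)); try apply HS; try assumption; try apply HP; try apply HPH;
        try apply HP. apply HNq. }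
  set (E := exp (T / h)). assert (HE : 0 < E) by apply exp_pos.
  assert (Hsup : forall K z, 0 <= K -> (forall s, - r <= s <= 0 -> z s = vsub (eta s) (eta s)) ->
    weighted_holder beta h K T z ->
    forall t i, - r <= t <= T -> Rabs (z t i) <= 2 * K * E).
  { intros K z HK Hz0 Hz t i Ht.
    assert (HKE : 0 <= K * E) by (apply Rmult_le_pos; lra).
    assert (Hz0' : forall s, - r <= s <= 0 -> z s i = 0).
    { intros s Hs; rewrite Hz0; [unfold vsub; ring|exact Hs]. }
    destruct (Rle_dec t 0) as [H1|H1]; [rewrite Hz0'; [rewrite Rabs_R0|]; lra|].
    assert (K1 := weighted_holder_sup beta h K T z Hbeta (ltac:(lra)) HK Hz t i (ltac:(lra))).
    rewrite (Hz0' 0) ?Rminus_0_r in K1; [|lra].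
    eapply Rle_trans; [exact K1|]. rewrite -(Rmult_1_r (2 * K * E)).
    apply Rmult_le_compat; [|apply rpow_ge0| |].
    - apply Rmult_le_pos; [lra|left; apply exp_pos].
    - apply Rmult_le_compat_l; [lra|apply exp_div_le; lra].
    - rewrite -(rpow_1l beta); apply rpow_le; lra. }
  assert (Hsub : forall x y, (forall s, - r <= s <= 0 -> x s = eta s) ->
    (forall s, - r <= s <= 0 -> y s = eta s) ->
    forall s, - r <= s <= 0 -> path_sub x y s = vsub (eta s) (eta s)).
  { intros x y Hx Hy s Hs. unfold path_sub. rewrite Hx ?Hy; easy. }
  set (c := 2 * N * E / (1 - q)).
  assert (Hc : 0 <= c) by (apply Rdiv_ge0; [apply Rmult_le_pos|]; lra).
  assert (Hlim : forall t i, exists l, - r <= t <= T -> forall n, Rabs (l - X n t i) <= c * q ^ n).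
  { intros t i. destruct (excluded_middle_informative (- r <= t <= T)) as [Ht|Ht];
      [|exists 0; tauto].
    destruct (geometric_limit (fun n => X n t i) (2 * N * E) q Hq) as [l Hl]; [|exists l; auto].
    intros n. replace (2 * N * E * q ^ n) with (2 * (N * q ^ n) * E) by ring.
    apply (Hsup (N * q ^ n) (path_sub (X (S n)) (X n)) (HNq n)); [|apply Hdiff|exact Ht].
    apply Hsub; apply HP. }
  set (x := fun t i => epsilon (inhabits 0)
    (fun l => - r <= t <= T -> forall n, Rabs (l - X n t i) <= c * q ^ n)).
  assert (Hxl : forall t i, - r <= t <= T -> forall n, Rabs (x t i - X n t i) <= c * q ^ n).
  { intros t i. apply (epsilon_spec (inhabits 0) _ (Hlim t i)). }
  assert (Hx0 : forall s, - r <= s <= 0 -> x s = eta s).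
  { intros s Hs. apply functional_extensionality; intros i. apply Rminus_diag_uniq.
    apply (zero_of_geometric _ c q Hq Hc); intros n.
    rewrite -(proj1 (HP n) s Hs). apply Hxl; lra. }
  assert (HxH : path_holder beta H (- r) T x).
  { intros i s t Hs Hst Ht. apply (le_of_all_eps _ _ (2 * c)); intros eps He.
    destruct (pow_small q eps Hq He) as [n Hn]. apply (Rmult_le_compat_l c) in Hn; [|lra].
    assert (K1 := Hxl s i (ltac:(lra)) n). assert (K2 := Hxl t i (ltac:(lra)) n).
    assert (K3 := HPH _ (HP n) i s t Hs Hst Ht). cbv beta in K3. abs_lra. }
  (* Uniform convergence is too weak to feed [contraction] again, so the weighted distance to the
     limit is estimated too: increments converge geometrically, and their limit is the increment of
     x. *)
  assert (Hxw : forall n, weighted_holder beta h (2 * (N * q ^ n)) T (path_sub x (X n))).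
  { intros n s t Hs Hst Ht Hts i.
    destruct (geometric_limit (fun n => X n t i - X n s i) (N * exp (t / h) * rpow (t - s) beta) q Hq)
      as [l Hl].
    - intros m. replace (N * exp (t / h) * rpow (t - s) beta * q ^ m)
        with (N * q ^ m * exp (t / h) * rpow (t - s) beta) by ring.
      replace (X (S m) t i - X (S m) s i - (X m t i - X m s i))
        with (path_sub (X (S m)) (X m) t i - path_sub (X (S m)) (X m) s i)
        by (unfold path_sub, vsub; ring).
      apply Hdiff; assumption.
    - set (K := N * exp (t / h) * rpow (t - s) beta) in *.
      assert (HK : 0 <= K).
      { apply Rmult_le_pos; [|apply rpow_ge0]. apply Rmult_le_pos; [lra|left; apply exp_pos]. }
      assert (HK' : K / (1 - q) = 2 * K) by (unfold q; field).
      rewrite HK' in Hl.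
      assert (Hlx : x t i - x s i - l = 0).
      { apply (zero_of_geometric _ (2 * c + 2 * K) q Hq); [lra|]. intros m.
        assert (K1 := Hxl s i (ltac:(lra)) m). assert (K2 := Hxl t i (ltac:(lra)) m).
        assert (K3 := Hl m). cbv beta in K3. abs_lra. }
      replace (path_sub x (X n) t i - path_sub x (X n) s i) with (l - (X n t i - X n s i))
        by (unfold path_sub, vsub; lra).
      eapply Rle_trans; [apply Hl|]. apply Req_le; unfold K; ring. }
  (* The Picard image x' of the limit and the limit itself are both geometrically close to X (n +
     1), hence equal on [-r, T]. *)
  destruct (Hstep x H HH HxH) as [x' Hx'].
  assert (Hxx' : forall t, - r <= t <= T -> x' t = x t).
  { intros t Ht. apply functional_extensionality; intros i. apply Rminus_diag_uniq.
    apply (zero_of_geometric _ (2 * N * E + c) q Hq).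
    { generalize (Rmult_le_pos N E HN (Rlt_le _ _ HE)); lra. }
    intros n.
    assert (K1 : weighted_holder beta h (2 * (N * q ^ n) / 2) T (path_sub x' (X (S n)))).
    { apply (Hcontr x (X n)); try assumption; try apply HS; try apply HP; try apply HPH;
        try apply HP; try apply Hxw. generalize (HNq n); lra. }
    assert (K2 := Hsup (2 * (N * q ^ n) / 2) _ (ltac:(generalize (HNq n); lra))
      (Hsub _ _ (proj1 Hx') (proj1 (HP (S n)))) K1 t i Ht).
    assert (K3 := Hxl t i Ht (S n)). simpl pow in K3.
    assert (Hcq : c * (q * q ^ n) <= c * q ^ n).
    { apply Rmult_le_compat_l; [exact Hc|]. generalize (pow_le q n (proj1 Hq)); unfold q; lra. }
    unfold path_sub, vsub in K2. abs_lra. }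
  exists x, H. split; [exact HH|split; [exact HxH|]].
  split; [exact Hx0|]. intros s t Hs Hst Ht i.
  rewrite -(Hxx' t) -?(Hxx' s); [|lra|lra]. apply (proj2 Hx'); assumption.
Qed.

(** Both paths are their own Picard images, so the weighted distance, at first at most 2 H, can be
    halved indefinitely. *)
Lemma fixed_point_unique {d} (r T : R) (f g : (Dr r -> Vec d) -> Vec d) (w : R -> R)
  (eta : R -> Vec d) (L nu delta Cw beta H : R) (x y : R -> Vec d) :
  0 < r -> 0 < T -> 0 < beta -> beta < nu -> nu <= 1 -> 0 <= delta <= 1 ->
  1 < beta * delta + nu -> 0 <= L -> 0 <= Cw -> 0 <= H ->
  lipschitz_coef L f -> smooth_coef delta L g -> holder_on w nu Cw 0 T ->
  path_holder beta H (- r) T x -> path_holder beta H (- r) T y ->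
  picard_step r T f g w eta x x -> picard_step r T f g w eta y y ->
  forall t, - r <= t <= T -> y t = x t.
Proof.
  intros Hr HT Hbeta Hbn Hn1 Hdelta Hbd HL HCw HH Hf Hg Hw Hxh Hyh Hx Hy t Ht.
  destruct (contraction r T f g w eta L nu delta Cw beta H) as [h [Hh Hcontr]]; try assumption.
  assert (Hn : forall n, weighted_holder beta h (2 * H * (/ 2) ^ n) T (path_sub y x)).
  { induction n as [|n IH].
    - simpl; rewrite Rmult_1_r. apply path_holder_weighted; [lra|lra|].
      intros i s u Hs Hsu Hu. unfold path_sub, vsub.
      assert (K1 := Hxh i s u (ltac:(lra)) Hsu Hu). assert (K2 := Hyh i s u (ltac:(lra)) Hsu Hu).
      cbv beta in K1, K2. abs_lra.
    - replace (2 * H * (/ 2) ^ S n) with (2 * H * (/ 2) ^ n / 2) by (simpl; field).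
      apply (Hcontr y x); try assumption; [|apply Hy|apply Hx].
      apply Rmult_le_pos; [lra|apply pow_le; lra]. }
  destruct (Rle_dec t 0) as [H1|H1].
  { rewrite (proj1 Hx) ?(proj1 Hy); [easy|lra|lra]. }
  apply functional_extensionality; intros i. apply Rminus_diag_uniq.
  assert (HE := exp_pos (t / h)). assert (Hp := rpow_ge0 h beta).
  apply (zero_of_geometric _ (2 * (2 * H) * exp (t / h) * rpow h beta) (/ 2)); [lra| |].
  - apply Rmult_le_pos; [apply Rmult_le_pos; lra|lra].
  - intros n.
    assert (K := weighted_holder_sup beta h (2 * H * (/ 2) ^ n) T _ Hbeta (ltac:(lra))
      (ltac:(apply Rmult_le_pos; [lra|apply pow_le; lra])) (Hn n) t i (ltac:(lra))).
    unfold path_sub, vsub in K. rewrite (proj1 Hx 0) ?(proj1 Hy 0) in K; [|lra|lra].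
    rewrite Rminus_diag Rminus_0_r in K. eapply Rle_trans; [exact K|].
    apply Req_le; ring.
Qed.

(** With nu in place of beta and h = 1, the gain h^(nu - beta) becomes 1 and the exponent nu
    survives. Gaps longer than 1 are covered by K', since there (t - s)^nu >= 1. *)
Lemma fixed_point_holder {d} (r T : R) (f g : (Dr r -> Vec d) -> Vec d) (w : R -> R)
  (eta : R -> Vec d) (L nu Cw beta H : R) (x : R -> Vec d) :
  0 < r -> 0 < T -> 0 < beta -> 0 <= nu -> nu <= 1 -> 1 < beta + nu -> 0 <= L ->
  0 <= Cw -> 0 <= H ->
  lipschitz_coef L f -> lipschitz_coef L g -> holder_on w nu Cw 0 T ->
  path_holder beta H (- r) T x -> picard_step r T f g w eta x x ->
  exists K, 0 <= K /\ path_holder nu K 0 T x.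
Proof.
  intros Hr HT Hbeta Hn0 Hn1 Hbn HL HCw HH Hf Hg Hw Hx [_ Hstep].
  set (Bf := fun F : (Dr r -> Vec d) -> Vec d =>
    vnorm (F (segment r x 0)) + L * H * rpow T beta).
  assert (HLH : 0 <= L * H) by (apply Rmult_le_pos; lra).
  assert (HLHT : 0 <= L * H * rpow T beta) by (apply Rmult_le_pos; [lra|apply rpow_ge0]).
  assert (HB0 : forall F, 0 <= Bf F) by (intros F; generalize (vnorm_ge0 (F (segment r x 0))); unfold Bf; lra).
  assert (HB : forall F, lipschitz_coef L F -> forall u i, 0 <= u <= T ->
    Rabs (F (segment r x u) i) <= Bf F).
  { intros F HF u i Hu. assert (K1 := vnorm_ge_coord (F (segment r x 0)) i).
    assert (K2 := coef_holder L F T beta H x i Hr Hbeta HH HF Hx 0 u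
      (ltac:(lra)) (ltac:(lra)) (ltac:(lra))). cbv beta in K2.
    assert (K3 : L * H * rpow (u - 0) beta <= L * H * rpow T beta).
    { apply Rmult_le_compat_l; [lra|apply rpow_le; lra]. }
    unfold Bf. abs_lra. }
  set (B := Bf f + Bf g).
  assert (HBB : Bf f <= B /\ Bf g <= B) by (generalize (HB0 f) (HB0 g); unfold B; lra).
  set (K := B * (1 + Cw) + sewing_const (beta + nu) * (L * H * Cw)).
  set (K' := 2 * (H * rpow T beta)).
  assert (HK : 0 <= K).
  { apply Rplus_le_le_0_compat; apply Rmult_le_pos; try lra.
    - generalize (HB0 f); lra.
    - apply sewing_const_ge0; lra.
    - apply Rmult_le_pos; lra. }
  assert (HK' : 0 <= K') by (generalize (Rmult_le_pos _ _ HH (rpow_ge0 T beta)); unfold K'; lra).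
  exists (K + K'); split; [lra|]. intros i s t Hs Hst Ht.
  assert (Hp := rpow_ge0 (t - s) nu). rewrite Rmult_plus_distr_r.
  assert (P1 := Rmult_le_pos _ _ HK Hp). assert (P2 := Rmult_le_pos _ _ HK' Hp).
  destruct (Rle_dec (t - s) 1) as [H1|H1].
  - destruct (Hstep s t Hs Hst Ht i) as [I1 [I2 [HI1 [HI2 Heq]]]].
    rewrite Heq.
    assert (K1 := increment_estimate _ _ w beta nu nu B (L * H) Cw 1 s t I1 I2
      (ltac:(lra)) (ltac:(lra)) Hn0 Hn1 Hbn (ltac:(generalize (HB0 f); lra)) HLH HCw Hst H1
      (Rle_refl 1) (fun u Hu => Rle_trans _ _ _ (HB f Hf u i (ltac:(lra))) (proj1 HBB))
      (Rle_trans _ _ _ (HB g Hg s i (ltac:(lra))) (proj2 HBB))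
      (holder_on_sub _ beta (L * H) 0 T s t Hs Ht (coef_holder L g T beta H x i Hr Hbeta HH Hg Hx))
      (holder_on_sub w nu Cw 0 T s t Hs Ht Hw) HI1 HI2).
    rewrite rpow_1l Rmult_1_l in K1. fold K in K1. lra.
  - assert (K1 := Hx i s t (ltac:(lra)) Hst Ht). cbv beta in K1.
    assert (K2 : H * rpow (t - s) beta <= H * rpow T beta).
    { apply Rmult_le_compat_l; [lra|apply rpow_le; lra]. }
    assert (K3 : 1 <= rpow (t - s) nu) by (rewrite -(rpow_1l nu); apply rpow_le; lra).
    apply (Rmult_le_compat_l _ _ _ HK') in K3. unfold K' in K3 at 1.
    generalize (Rmult_le_pos _ _ HH (rpow_ge0 T beta)); lra.
Qed.

(** * Passage between coordinates and the notions of the theorem *)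

Lemma path_holder_of_is_holder {d} (alpha : R) (x : R -> Vec d) (a b : R) :
  is_holder alpha x a b -> exists H, 0 <= H /\ path_holder alpha H a b x.
Proof.
  intros [K HK]. exists (Rabs K). split; [apply Rabs_pos|]. intros i s t Hs [Hst| <-] Ht.
  - eapply Rle_trans; [apply (vnorm_ge_coord (vsub (x t) (x s)))|].
    eapply Rle_trans; [apply HK; assumption|].
    rewrite rpow_pos; [|lra]. apply Rmult_le_compat_r; [left; apply exp_pos|apply Rle_abs].
  - rewrite !Rminus_diag Rabs_R0 rpow_0; lra.
Qed.

Lemma is_holder_of_path_holder {d} (alpha H : R) (x : R -> Vec d) (a b : R) :
  0 <= H -> path_holder alpha H a b x -> is_holder alpha x a b.
Proof.
  intros HH Hx. exists ((1 + INR d) * H). intros s t Hs Hst Ht.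
  rewrite -rpow_pos; [|lra]. rewrite Rmult_assoc.
  apply vnorm_le; [apply Rmult_le_pos; [lra|apply rpow_ge0]|].
  intros i. apply (Hx i); lra.
Qed.

Lemma holder_on_of_is_holder1 (alpha : R) (w : R -> R) (a b : R) :
  is_holder1 alpha w a b -> exists C, 0 <= C /\ holder_on w alpha C a b.
Proof.
  intros [K HK]. exists (Rabs K). split; [apply Rabs_pos|]. intros s t Hs [Hst| <-] Ht.
  - eapply Rle_trans; [apply HK; assumption|].
    rewrite rpow_pos; [|lra]. apply Rmult_le_compat_r; [left; apply exp_pos|apply Rle_abs].
  - rewrite !Rminus_diag Rabs_R0 rpow_0; lra.
Qed.

Lemma solves_of_picard_step {d} (r T : R) (f g : (Dr r -> Vec d) -> Vec d) (w : R -> R)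
  (eta x : R -> Vec d) :
  0 < r -> picard_step r T f g w eta x x -> solves r T f g w eta x.
Proof.
  intros Hr [Hx0 Hstep]. split; [exact Hx0|]. intros t Ht.
  assert (Hi := Hstep 0 t (Rle_refl 0) (proj1 Ht) (proj2 Ht)).
  set (c1 := fun i => constructive_indefinite_description _ (Hi i)).
  set (c2 := fun i => constructive_indefinite_description _ (proj2_sig (c1 i))).
  assert (Hc := fun i => proj2_sig (c2 i)). cbv beta in Hc.
  exists (fun i => proj1_sig (c1 i)), (fun i => proj1_sig (c2 i)).
  split; [apply RS_integral_of_scalar; intros i; apply (Hc i)|].
  split; [apply RS_integral_of_scalar; intros i; apply (Hc i)|].
  apply functional_extensionality; intros i. destruct (Hc i) as [_ [_ Heq]].
  rewrite -(Hx0 0); [|lra]. unfold vadd. lra.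
Qed.

(** [solves] provides integrals from 0 only. By uniqueness of integrals x agrees on [0, T] with its
    Picard image x', and so inherits the increments over every [s, t]. *)
Lemma picard_step_of_solves {d} (r T : R) (f g : (Dr r -> Vec d) -> Vec d) (w : R -> R)
  (eta x x' : R -> Vec d) :
  0 < r -> solves r T f g w eta x -> picard_step r T f g w eta x x' ->
  picard_step r T f g w eta x x.
Proof.
  intros Hr [Hx0 Hx] [Hx0' Hstep]. split; [exact Hx0|].
  assert (Heq : forall t i, 0 <= t <= T -> x t i = x' t i).
  { intros t i Ht. destruct (Hx t Ht) as [I1 [I2 [HI1 [HI2 ->]]]].
    destruct (Hstep 0 t (Rle_refl 0) (proj1 Ht) (proj2 Ht) i) as [J1 [J2 [HJ1 [HJ2 Hj]]]].
    rewrite (Hx0' 0) in Hj; [|lra].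
    apply (RS_scalar_of_integral _ _ _ _ _ i) in HI1.
    apply (RS_scalar_of_integral _ _ _ _ _ i) in HI2.
    rewrite -(RS_scalar_unique _ _ _ _ _ _ (proj1 Ht) HI1 HJ1) in Hj.
    rewrite -(RS_scalar_unique _ _ _ _ _ _ (proj1 Ht) HI2 HJ2) in Hj.
    unfold vadd. lra. }
  intros s t Hs Hst Ht i. rewrite !Heq; [|lra|lra]. apply Hstep; assumption.
Qed.

Theorem theorem1 (d : nat) (r T nu delta beta : R) (w : R -> R)
  (f g : (Dr r -> Vec d) -> Vec d) :
  0 < r -> 0 < T ->
  1 / 2 < nu -> nu <= 1 ->
  is_holder1 nu w 0 T -> holder_little_o nu w T ->
  (1 - nu) / nu < delta -> delta <= 1 ->
  0 < beta -> beta < nu -> beta * delta + nu > 1 ->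
  Hf r f -> Hg r delta g ->
  forall eta : R -> Vec d, is_holder beta eta (- r) 0 ->
    exists x : R -> Vec d,
      (is_holder beta x (- r) T /\ solves r T f g w eta x) /\
      (forall y : R -> Vec d, is_holder beta y (- r) T -> solves r T f g w eta y ->
         forall t, - r <= t <= T -> y t = x t) /\
      is_holder nu x 0 T.
Proof.
  intros Hr HT Hnu Hnu1 Hw _ Hd Hd1 Hbeta Hbn Hbd Hf Hg eta Heta.
  assert (Hd0 : 0 <= (1 - nu) / nu) by (apply Rdiv_ge0; lra).
  assert (Hbn1 : 1 < beta + nu).
  { assert (beta * delta <= beta * 1) by (apply Rmult_le_compat_l; lra). lra. }
  destruct (path_holder_of_is_holder _ _ _ _ Heta) as [H0 [HH0 Hetah]].
  destruct (holder_on_of_is_holder1 _ _ _ _ Hw) as [Cw [HCw Hwh]].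
  destruct (Hf_coord f Hf) as [Lf [HLf Hfc]].
  destruct (Hg_coord delta g (ltac:(lra)) Hg) as [Lg [HLg Hgc]].
  set (L := Lf + Lg). assert (HL : 0 <= L) by (unfold L; lra).
  assert (HfL : lipschitz_coef L f).
  { intros xi zeta Cxi Czeta M _ _ D HD Hb i. eapply Rle_trans; [apply (Hfc xi zeta Cxi Czeta D HD Hb)|].
    apply Rmult_le_compat_r; unfold L; lra. }
  assert (HgL : smooth_coef delta L g).
  { intros M HM. destruct (Hgc M HM) as [LM [HLM H]]. exists LM; split; [exact HLM|].
    intros xi1 eta1 xi2 eta2 C1 C2 C3 C4 B1 B2 B3 B4 D E P HD HE HP HbD HbE HbP1 HbP2 i.
    eapply Rle_trans; [apply (H xi1 eta1 xi2 eta2 C1 C2 C3 C4 B1 B2 B3 B4 D E P); assumption|].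
    apply Rplus_le_compat_r. apply Rmult_le_compat_r; unfold L; lra. }
  assert (HgL' := smooth_coef_lipschitz delta L g HgL).
  destruct (fixed_point_exists r T f g w eta L nu delta Cw beta H0)
    as [x [H [HH [Hxh Hx]]]]; try assumption; try lra.
  exists x. split; [|split].
  - split; [apply (is_holder_of_path_holder beta H); assumption|].
    apply solves_of_picard_step; assumption.
  - intros y Hyh Hy.
    destruct (path_holder_of_is_holder _ _ _ _ Hyh) as [H' [HH' Hyh']].
    destruct (picard_step_exists r T f g w eta y L L nu Cw beta H') as [y' Hy'];
      try assumption; try lra.
    assert (Hyy := picard_step_of_solves r T f g w eta y y' Hr Hy Hy').
    assert (Hmono : forall (z : R -> Vec d) c, c <= H + H' ->
      path_holder beta c (- r) T z -> path_holder beta (H + H') (- r) T z).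
    { intros z c Hc Hz i s t Hs Hst Ht. eapply Rle_trans; [apply (Hz i); assumption|].
      apply Rmult_le_compat_r; [apply rpow_ge0|exact Hc]. }
    (* The Hölder constant of y is unrelated to that of x; a common one gives uniqueness in the
       whole Hölder class rather than in a ball. *)
    apply (fixed_point_unique r T f g w eta L nu delta Cw beta (H + H')); try assumption; try lra.
    + apply (Hmono x H); [lra|exact Hxh].
    + apply (Hmono y H'); [lra|exact Hyh'].
  - destruct (fixed_point_holder r T f g w eta L nu Cw beta H x) as [K [HK Hxn]];
      try assumption; try lra.
    apply (is_holder_of_path_holder nu K); assumption.
Qed.
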